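(* Let $n\ge 2$ be an integer. A mapping $L: (\mathcal{P}_n, g) \to (\mathcal{P}_n, g)$ is an isometry if and only if there exists a matrix $M \in GL_n$ such that $$L = \Gamma_M \quad\text{or}\quad L = \Gamma_M \circ \varphi \quad\text{or}\quad L = \Gamma_M \circ \psi \quad\text{or}\quad L = \Gamma_M \circ \varphi \circ \psi .$$
   Context: $GL_n$ is the group of non-singular real $n\times n$ matrices. $\mathcal{P}_n$ is the manifold of positive definite real symmetric $n\times n$ matrices, endowed with the trace metric $g_A(V,W)=\mathrm{tr}(A^{-1}VA^{-1}W)$ for $A\in\mathcal{P}_n$ and $V,W$ real symmetric matrices (a Riemannian metric on $\mathcal{P}_n$). The following mappings are considered on $\mathcal{P}_n$: $\Gamma_M(A)=MAM^T$ (congruence by $M$), $\varphi(A)=A^{-1}$ (inversion), and $\psi(A)=|\det(A)|^{-2/n}A$. An isometry is a diffeomorphism preserving the metric tensor. *)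

(* Defs.v *)
From HB Require Import structures.
From mathcomp Require Import all_boot all_order all_algebra.
From mathcomp Require Import all_classical all_reals all_analysis.

Set Implicit Arguments.
Unset Strict Implicit.
Unset Printing Implicit Defensive.

Import Order.TTheory GRing.Theory Num.Theory.
Import numFieldNormedType.Exports.

Local Open Scope classical_set_scope.
Local Open Scope ring_scope.

(* C^k maps on a set U that is (relatively) open in a linear subspace S of V:
   f and its iterated derivatives along fixed directions of S, up to order k,
   exist and are continuous on U.  Since U is open in S, a derivative at a
   point of U in a direction of S does not depend on f outside U. *)
Fixpoint Ck (R : realType) (V W : normedModType R) (S U : set V) (k : nat)
    (f : V -> W) : Prop :=
  {within U, continuous f} /\
  if k is k'.+1 then
    forall v, S v -> (forall a, U a -> derivable f a v) /\
                     Ck S U k' (fun a => 'D_v f a)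
  else True.

Definition smooth (R : realType) (V W : normedModType R) (S U : set V)
    (f : V -> W) : Prop :=
  forall k, Ck S U k f.

(* f is a map U -> U; only its values on U matter. *)
Definition diffeomorphism (R : realType) (V : normedModType R) (S U : set V)
    (f : V -> V) : Prop :=
  [/\ set_fun U U f, smooth S U f &
      exists2 g : V -> V, set_fun U U g /\ smooth S U g &
                          {in U, cancel f g} /\ {in U, cancel g f}].

Section TraceMetric.
Variables (R : realType) (n : nat).

Definition Symm : set 'M[R]_n := [set V | V \is symmetricmx].

Definition posdefmx : set 'M[R]_n :=
  [set A | Symm A /\
           forall x : 'cV[R]_n, x != 0 -> 0 < (x^T *m A *m x) ord0 ord0].

Definition trace_metric (A V W : 'M[R]_n) : R :=
  \tr (invmx A *m V *m invmx A *m W).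

(* The tangent space of posdefmx at every point is Symm, and the differential
   of L at A maps V to 'D_V L A. *)
Definition trace_isometry (L : 'M[R]_n -> 'M[R]_n) : Prop :=
  diffeomorphism Symm posdefmx L /\
  forall A V W, posdefmx A -> Symm V -> Symm W ->
    trace_metric (L A) ('D_V L A) ('D_W L A) = trace_metric A V W.

Definition congruence (M A : 'M[R]_n) : 'M[R]_n := M *m A *m M^T.

Definition inversion (A : 'M[R]_n) : 'M[R]_n := invmx A.

Definition det_scaling (A : 'M[R]_n) : 'M[R]_n :=
  (`|\det A| `^ (- (2 / n%:R))) *: A.

End TraceMetric.

Arguments Symm R n : clear implicits.
Arguments posdefmx R n : clear implicits.

(* Main.v *)
Require Import Defs.
From mathcomp Require Import all_boot all_order all_algebra.
From mathcomp Require Import all_classical all_reals all_analysis.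
From mathcomp Require Import perm complex.
From mathcomp Require Import ring lra.

Set Implicit Arguments.
Unset Strict Implicit.
Unset Printing Implicit Defensive.

Import Order.TTheory GRing.Theory Num.Theory.
Import numFieldNormedType.Exports.

Local Open Scope classical_set_scope.
Local Open Scope ring_scope.
Local Open Scope sesquilinear_scope.

(** The positive cone carries a metric of nonpositive curvature whose geodesics and
    geodesic symmetries are explicit, and an isometry is determined by its value
    and its differential at one point. The theorem follows by finding all
    possible differentials.

    Let L be an isometry. Differentiating the isometry relation, as in the proof of
    Koszul's formula (iso_hessian), shows that L carries geodesics, the solutions of
    c'' = c' c^-1 c', to geodesics (iso_geodesic). Consequently L commutes with the
    geodesic symmetries B |-> A B^-1 A (iso_reflect). After a congruence L fixes the
    identity. Let T be its differential there. Uniqueness of geodesics gives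
    L (exp X) = exp (T X) (normalized_exp), and the symmetries give
    L (A B A) = L A * L B * L A. Differentiating the latter in two ways yields
    T (B Y B^-1 + B^-1 Y B) = C (T Y) C^-1 + C^-1 (T Y) C for C = L B
    (normalized_derive_cosh): T conjugates the operator 2 cosh (ad X) into
    2 cosh (ad (T X)).

    The rest of this direction is linear algebra. The spectrum of the operator for
    X = x x^T with x a unit vector shows that T X has two eigenvalues that
    differ by 1, one of them simple (cosh_map_outer1). Up to the sign of T, this leaves
    T (x x^T) = u u^T and T (x x^T) = - u u^T + (2 / n) 1, with the same case for all x
    because T preserves angles between the x x^T (rank1_image_transfer). The second case
    is the differential of A |-> (|det A| ^ (- 2 / n) A)^-1, and the first one is settled by
    Wigner's theorem: T X = Q X Q^T with Q orthogonal (wigner). Exponentiating the four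
    possibilities gives the four forms (isometry_form).

    Conversely, each form is a congruence of A |-> |det A|^k A or of
    A |-> |det A|^k A^-1, with k a root of a quadratic equation that makes this map an
    involution (det_power_mapK) and makes it preserve the metric (det_power_map_metric).
    Smoothness holds because these maps and all their derivatives are built from
    entries by sums, products and real powers (elementarymx_smooth). *)

(** * The spectral theorem for real symmetric matrices *)

Section Spectral.
Variable R : realType.

Lemma SymmE n (A : 'M[R]_n) : Symm R n A <-> A^T = A.
Proof.
rewrite /Symm /= qualifE /= expr0 scale1r map_mx_id //.
by split=> [/eqP <-|->]; rewrite ?eqxx.
Qed.

(** Over the complex numbers a symmetric real matrix is hermitian, so it has an
    eigenvalue z, and z is real: computing w A w* in two ways gives z |w|^2 and
    its conjugate. A real root of the characteristic polynomial of A has a real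
    eigenvector. *)
Lemma symmetric_eigenvector n (A : 'M[R]_n.+1) : A^T = A ->
  exists (a : R) (v : 'rV[R]_n.+1), v != 0 /\ v *m A = a *: v.
Proof.
move=> symA.
pose C := complex R; pose f := @real_complex R : R -> C.
have [z] := @eigenvalue_closed C _ (map_mx f A) isT.
case/eigenvalueP => w wA w0.
have conjf (x : R) : (f x)^* = f x.
  by apply/eqP; rewrite eq_complex /= oppr0 !eqxx.
have zreal : z^* = z.
  have h1 : w *m map_mx f A *m w^t* = z *: (w *m w^t*).
    by rewrite wA scalemxAl.
  have h2 : w *m map_mx f A *m w^t* = z^* *: (w *m w^t*).
    rewrite -mulmxA; have -> : map_mx f A *m w^t* = z^* *: w^t*.
      rewrite -[LHS]trmxCK.
      have -> : (map_mx f A *m w^t*)^t* = w *m map_mx f A.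
        rewrite trmx_mul map_mxM /= trmxCK; congr (_ *m _).
        by apply/matrixP => i j; rewrite !mxE conjf -[in LHS]symA mxE.
      by rewrite wA; apply/matrixP => i j; rewrite !mxE rmorphM.
    by rewrite scalemxAr.
  have n0 : w *m w^t* != 0.
    apply/negP => /eqP/matrixP /(_ 0 0); rewrite -dotmxE mxE => /eqP.
    by rewrite dnorm_eq0 (negbTE w0).
  apply/eqP; rewrite -subr_eq0; apply/eqP.
  have := esym (etrans (esym h1) h2) => /eqP.
  by rewrite -subr_eq0 -scalerBl scaler_eq0 (negbTE n0) orbF => /eqP.
have [a za] : exists a, z = f a.
  case: z zreal {wA} => a b /eqP; rewrite eq_complex /= eqxx /= => /eqP bb.
  exists a; apply/eqP; rewrite eq_complex /= eqxx /=; apply/eqP; lra.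
have /eigenvalueP [v vA v0] : eigenvalue A a.
  rewrite eigenvalue_root_char -(fmorph_root f) map_char_poly.
  rewrite -eigenvalue_root_char; apply/eigenvalueP; exists w => //.
  by rewrite [LHS]wA za.
by exists a, v.
Qed.

Lemma dot_sum n (v : 'rV[R]_n) : (v *m v^T) 0 0 = \sum_i v 0 i ^+ 2.
Proof. by rewrite mxE; apply: eq_bigr => i _; rewrite mxE. Qed.

Lemma dot_gt0 n (v : 'rV[R]_n) : v != 0 -> 0 < (v *m v^T) 0 0.
Proof.
move=> v0; rewrite lt_def dot_sum sumr_ge0 ?andbT; last by move=> i _; exact: sqr_ge0.
apply: contra v0; rewrite psumr_eq0; last by move=> i _; exact: sqr_ge0.
move=> /allP h; apply/eqP/rowP => j; rewrite mxE; apply/eqP.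
by rewrite -sqrf_eq0; apply: h; rewrite mem_index_enum.
Qed.

(** Reflect along u - e, where e is the first basis vector; this is how a unit
    vector is completed to an orthonormal basis. *)
Lemma householder n (u : 'rV[R]_n.+1) : u *m u^T = 1%:M ->
  exists2 H : 'M[R]_n.+1, H *m H^T = 1%:M & delta_mx 0 0 *m H = u.
Proof.
move=> uu; set e := delta_mx 0 0 : 'rV[R]_n.+1.
have [w wdef] : exists w, w = u - e by exists (u - e).
have ee : e *m e^T = 1%:M.
  rewrite /e trmx_delta mul_delta_mx; apply/matrixP => i j.
  by rewrite !ord1 !mxE.
case: (eqVneq w 0) => [/eqP|w0].
  rewrite wdef subr_eq0 => /eqP ->; exists 1%:M; first by rewrite trmx1 mulmx1.
  by rewrite mulmx1.
pose k := (w *m w^T) 0 0; have k0 : k != 0 by rewrite gt_eqF // dot_gt0.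
have wwE : w *m w^T = k%:M by rewrite [LHS]mx11_scalar.
pose s := (e *m u^T) 0 0.
have euE : e *m u^T = s%:M by rewrite [LHS]mx11_scalar.
have ueE : u *m e^T = s%:M by rewrite -[LHS]trmxK trmx_mul trmxK euE tr_scalar_mx.
have kE : k = 2 - 2 * s.
  rewrite /k wdef linearB /= mulmxBl !mulmxBr uu ee euE ueE !mxE /=; ring.
have ewE : e *m w^T = (s - 1)%:M.
  by rewrite wdef linearB /= mulmxBr ee euE raddfB.
exists (1%:M - (2 / k) *: (w^T *m w)).
  have -> : (1%:M - (2 / k) *: (w^T *m w))^T = 1%:M - (2 / k) *: (w^T *m w).
    by rewrite raddfB /= trmx1 linearZ /= trmx_mul trmxK.
  rewrite mulmxBl !mulmxBr !mul1mx.
  rewrite !mulmx1 -scalemxAl -scalemxAr mulmxA -[w^T *m w *m _]mulmxA wwE.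
  rewrite mul_mx_scalar -scalemxAl !scalerA.
  have -> : 2 / k * (2 / k * k) = 2 / k + 2 / k by field.
  by rewrite scalerDl opprB addrK subrK.
rewrite mulmxBr mulmx1 -scalemxAr mulmxA ewE mul_scalar_mx scalerA.
have -> : 2 / k * (s - 1) = -1 by rewrite kE; field; rewrite -kE.
by rewrite scaleN1r opprK wdef addrC subrK.
Qed.

(** Rotate a unit eigenvector onto the first basis vector: by symmetry the
    matrix becomes block diagonal, and induction applies to the lower block. *)
Lemma symmetric_spectral n (A : 'M[R]_n) : A^T = A ->
  exists (Q : 'M[R]_n) (d : 'rV[R]_n),
    Q *m Q^T = 1%:M /\ A = Q *m diag_mx d *m Q^T.
Proof.
elim: n A => [|n IH] A symA.
  by exists 1%:M, 0; split; apply/matrixP => -[].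
have [a [v [v0 vA]]] := symmetric_eigenvector symA.
pose k := (v *m v^T) 0 0; have k0 : 0 < k by exact: dot_gt0.
pose u := (Num.sqrt k)^-1 *: v.
have uu : u *m u^T = 1%:M.
  rewrite /u linearZ /= -scalemxAl -scalemxAr scalerA -invfM -expr2.
  by rewrite sqr_sqrtr ?ltW // [v *m _]mx11_scalar -/k scale_scalar_mx mulVf ?gt_eqF.
have uA : u *m A = a *: u by rewrite -scalemxAl vA scalerA mulrC -scalerA.
have [H HH Hu] := householder uu.
have HtH : H^T *m H = 1%:M by exact: mulmx1C.
have [B Bdef] : exists B : 'M[R]_(1 + n), B = H *m A *m H^T by eexists.
have symB : B^T = B by rewrite Bdef !trmx_mul trmxK symA mulmxA.
have eB : delta_mx 0 0 *m B = a *: (delta_mx 0 0 : 'rV[R]_(1 + n)).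
  by rewrite Bdef !mulmxA Hu uA -scalemxAl -Hu -mulmxA HH mulmx1.
have B0 j : B 0 j = a *+ (j == 0).
  have /rowP /(_ j) := eB; rewrite -rowE !mxE /= => ->.
  by rewrite mulr_natr.
have l0 : lshift n (0 : 'I_1) = 0 :> 'I_n.+1 by exact: val_inj.
have ul : ulsubmx B = a%:M.
  apply/matrixP => i j; rewrite !ord1 !mxE.
  by rewrite !l0 B0.
have ur : ursubmx B = 0.
  apply/matrixP => i j; rewrite !ord1 !mxE.
  by rewrite l0 B0.
have dl : dlsubmx B = 0 by rewrite -[B]symB -trmx_ursub ur trmx0.
have [|Q [d [QQ dr]]] := IH (drsubmx B); first by rewrite trmx_drsub symB.
have BE : B = block_mx a%:M 0 0 (drsubmx B) by rewrite -[LHS]submxK ul ur dl.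
have [P Pdef] : exists P : 'M[R]_(1 + n), P = block_mx 1%:M 0 0 Q by eexists.
have PT : P^T = block_mx 1%:M 0 0 Q^T.
  by rewrite Pdef tr_block_mx !trmx0 trmx1.
have PP : P *m P^T = 1%:M.
  rewrite PT Pdef mulmx_block !mulmx0 !mul0mx.
  by rewrite !addr0 add0r mulmx1 QQ -scalar_mx_block.
have PBP : B = P *m diag_mx (row_mx a%:M d) *m P^T.
  rewrite diag_mx_row PT Pdef !mulmx_block !mulmx0 !mul0mx.
  rewrite !addr0 !add0r ?mulmx0 ?mulmx1 ?mul1mx ?mul0mx BE dr ?mulmx1; congr block_mx.
  by apply/matrixP => i j; rewrite !ord1 !mxE.
exists (H^T *m P), (row_mx a%:M d : 'rV[R]_(1 + n)); split.
  by rewrite trmx_mul trmxK mulmxA -[_ *m P^T]mulmxA PP mulmx1.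
have -> : A = H^T *m B *m H.
  by rewrite Bdef !mulmxA HtH mul1mx -mulmxA HtH mulmx1.
by rewrite trmx_mul trmxK PBP !mulmxA.
Qed.

End Spectral.

(** * Positive definite matrices *)

Section PosDef.
Variables (R : realType) (n : nat).
Implicit Types (A B M Q V W : 'M[R]_n) (d : 'rV[R]_n).

Local Notation P := (posdefmx R n).
Local Notation qf A x := ((x^T *m A *m x) ord0 ord0).

(** The matrix exponential of the symmetric matrix Q diag(d) Q^T. By
    posdef_spectral_exp every positive definite matrix has this form, which makes
    logarithms, powers and geodesics computable on eigenvalues. *)
Definition spectral_exp Q d : 'M[R]_n := Q *m diag_mx (map_mx expR d) *m Q^T.

Lemma spectral_exp_tr Q d : (spectral_exp Q d)^T = spectral_exp Q d.
Proof. by rewrite /spectral_exp !trmx_mul trmxK tr_diag_mx mulmxA. Qed.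

Lemma orthoC Q : Q *m Q^T = 1%:M -> Q^T *m Q = 1%:M.
Proof. exact: mulmx1C. Qed.

Lemma mulmx_orthoK m Q (A : 'M[R]_(m, n)) : Q *m Q^T = 1%:M -> A *m Q *m Q^T = A.
Proof. by move=> QQ; rewrite -mulmxA QQ mulmx1. Qed.

Lemma ortho_mulmxK m Q (A : 'M[R]_(n, m)) : Q *m Q^T = 1%:M -> Q *m (Q^T *m A) = A.
Proof. by move=> QQ; rewrite mulmxA QQ mul1mx. Qed.

Lemma ortho_mulmxTK m Q (A : 'M[R]_(n, m)) : Q *m Q^T = 1%:M -> Q^T *m (Q *m A) = A.
Proof. by move=> /orthoC QQ; rewrite mulmxA QQ mul1mx. Qed.

Lemma ortho_conjM Q A B : Q *m Q^T = 1%:M ->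
  (Q *m A *m Q^T) *m (Q *m B *m Q^T) = Q *m (A *m B) *m Q^T.
Proof. by move=> /orthoC QQ; rewrite !mulmxA -[_ *m Q^T *m Q]mulmxA QQ mulmx1. Qed.

Lemma spectral_expD Q d e : Q *m Q^T = 1%:M -> spectral_exp Q d *m spectral_exp Q e = spectral_exp Q (d + e).
Proof.
move=> QQ; rewrite /spectral_exp ortho_conjM // mulmx_diag; congr (_ *m diag_mx _ *m _).
by apply/rowP => i; rewrite !mxE expRD.
Qed.

Lemma spectral_exp0 Q : Q *m Q^T = 1%:M -> spectral_exp Q 0 = 1%:M.
Proof.
move=> QQ; rewrite /spectral_exp (_ : map_mx _ _ = const_mx 1).
  by rewrite diag_const_mx mulmx1.
by apply/rowP => i; rewrite !mxE expR0.
Qed.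

Lemma spectral_expNr Q d : Q *m Q^T = 1%:M -> spectral_exp Q d *m spectral_exp Q (- d) = 1%:M.
Proof. by move=> QQ; rewrite spectral_expD // subrr spectral_exp0. Qed.

Lemma spectral_expNl Q d : Q *m Q^T = 1%:M -> spectral_exp Q (- d) *m spectral_exp Q d = 1%:M.
Proof. by move=> QQ; rewrite spectral_expD // addNr spectral_exp0. Qed.

Lemma mulmx1_inv A B : A *m B = 1%:M -> invmx A = B.
Proof.
by move=> AB; have [uA _] := mulmx1_unit AB; rewrite -[LHS]mulmx1 -AB mulKmx.
Qed.

Lemma spectral_exp_inv Q d : Q *m Q^T = 1%:M -> invmx (spectral_exp Q d) = spectral_exp Q (- d).
Proof. by move=> QQ; apply: mulmx1_inv; rewrite spectral_expNr. Qed.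

Lemma spectral_exp_det Q d : Q *m Q^T = 1%:M -> \det (spectral_exp Q d) = expR (\sum_i d 0 i).
Proof.
move=> QQ; rewrite /spectral_exp !det_mulmx det_diag mulrAC -det_mulmx QQ det1 mul1r.
by rewrite expR_sum; apply: eq_bigr => i _; rewrite mxE.
Qed.

Lemma posdef_sym A : P A -> A^T = A.
Proof. by case=> /SymmE. Qed.

Lemma qf_diag d (x : 'cV[R]_n) : qf (diag_mx d) x = \sum_i d 0 i * x i 0 ^+ 2.
Proof.
rewrite mxE; apply: eq_bigr => i _.
by rewrite mul_mx_diag !mxE expr2 mulrAC mulrC mulrA mulrC mulrA.
Qed.

Lemma sumsq_gt0 (x : 'cV[R]_n) : x != 0 -> 0 < \sum_i x i 0 ^+ 2.
Proof.
move=> x0; rewrite lt_def sumr_ge0 ?andbT; last by move=> i _; exact: sqr_ge0.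
apply: contra x0; rewrite psumr_eq0; last by move=> i _; exact: sqr_ge0.
move=> /allP h; apply/eqP/colP => j; rewrite mxE; apply/eqP.
by rewrite -sqrf_eq0; apply: h; rewrite mem_index_enum.
Qed.

Lemma posdef_congr M A : M \in unitmx -> P A -> P (M *m A *m M^T).
Proof.
move=> uM [/SymmE sA pA]; split; first by apply/SymmE; rewrite !trmx_mul trmxK sA mulmxA.
move=> x x0; have := pA (M^T *m x); rewrite trmx_mul trmxK !mulmxA; apply.
apply: contra x0 => /eqP h; apply/eqP.
by rewrite -[x](mulKmx (_ : M^T \in unitmx)) ?unitmx_tr // h mulmx0.
Qed.

Lemma posdef_diag d : (forall i, 0 < d 0 i) -> P (diag_mx d).
Proof.
move=> d0; split; first by apply/SymmE; rewrite tr_diag_mx.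
move=> x x0; rewrite qf_diag lt_def sumr_ge0 ?andbT; last first.
  by move=> i _; rewrite mulr_ge0 ?sqr_ge0 // ltW.
apply: contra x0; rewrite psumr_eq0; last first.
  by move=> i _; rewrite mulr_ge0 ?sqr_ge0 // ltW.
move=> /allP h; apply/eqP/colP => j; rewrite mxE; apply/eqP.
have /= := h j (mem_index_enum _); rewrite mulf_eq0 (gt_eqF (d0 j)) /=.
by rewrite sqrf_eq0.
Qed.

Lemma ortho_unit Q : Q *m Q^T = 1%:M -> Q \in unitmx.
Proof. by case/mulmx1_unit. Qed.

Lemma spectral_exp_posdef Q d : Q *m Q^T = 1%:M -> P (spectral_exp Q d).
Proof.
move=> QQ; apply: posdef_congr; first exact: ortho_unit.
by apply: posdef_diag => i; rewrite mxE expR_gt0.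
Qed.

Lemma posdef1 : P 1%:M.
Proof. by rewrite -(@spectral_exp0 1%:M) ?trmx1 ?mulmx1 //; apply: spectral_exp_posdef; rewrite trmx1 mulmx1. Qed.

Lemma posdef_spectral_exp A : P A -> exists Q d, Q *m Q^T = 1%:M /\ A = spectral_exp Q d.
Proof.
move=> PA; have [Q [e [QQ AE]]] := symmetric_spectral (posdef_sym PA).
exists Q, (map_mx (@ln R) e); split => //; rewrite AE /spectral_exp; congr (_ *m diag_mx _ *m _).
have DE : diag_mx e = Q^T *m A *m (Q^T)^T.
  have QQ' := orthoC QQ.
  by rewrite AE trmxK !mulmxA QQ' mul1mx -mulmxA QQ' mulmx1.
have [_ PD] : P (diag_mx e).
  by rewrite DE; apply: posdef_congr; rewrite ?unitmx_tr ?ortho_unit.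
apply/rowP => i; rewrite !mxE lnK // posrE.
have := PD (delta_mx i 0); rewrite qf_diag (bigD1 i) //= big1; last first.
  by move=> j ji; rewrite mxE (negbTE ji) expr0n mulr0.
rewrite mxE !eqxx expr1n mulr1 addr0; apply.
by apply/eqP => /colP /(_ i); rewrite !mxE !eqxx => /eqP; rewrite oner_eq0.
Qed.

Lemma posdef_det A : P A -> 0 < \det A.
Proof. by case/posdef_spectral_exp => Q [d [QQ ->]]; rewrite spectral_exp_det ?expR_gt0. Qed.

Lemma posdef_unit A : P A -> A \in unitmx.
Proof. by move=> /posdef_det A0; rewrite unitmxE unitfE gt_eqF. Qed.

Lemma posdef_inv A : P A -> P (invmx A).
Proof.
by case/posdef_spectral_exp => Q [d [QQ ->]]; rewrite spectral_exp_inv //; exact: spectral_exp_posdef.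
Qed.

Lemma posdefZ (k : R) A : 0 < k -> P A -> P (k *: A).
Proof.
move=> k0 [/SymmE sA pA]; split; first by apply/SymmE; rewrite linearZ /= sA.
by move=> x x0; rewrite -scalemxAr -scalemxAl mxE mulr_gt0 // pA.
Qed.

Lemma posdefD A B : P A -> P B -> P (A + B).
Proof.
move=> [/SymmE sA pA] [/SymmE sB pB]; split.
  by apply/SymmE; rewrite linearD /= sA sB.
by move=> x x0; rewrite mulmxDr mulmxDl mxE addr_gt0 ?pA ?pB.
Qed.

Lemma posdef_convex A B (t : R) : P A -> P B -> 0 <= t <= 1 -> P (t *: (B - A) + A).
Proof.
move=> PA PB /andP[t0 t1].
have -> : t *: (B - A) + A = t *: B + (1 - t) *: A.
  by rewrite scalerBr scalerBl scale1r addrAC addrA.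
have [->|tn0] := eqVneq t 0; first by rewrite scale0r add0r subr0 scale1r.
have [->|tn1] := eqVneq t 1; first by rewrite scale1r subrr scale0r addr0.
by apply: posdefD; apply: posdefZ => //; rewrite ?subr_gt0 lt_def ?tn0 ?t0 // eq_sym tn1.
Qed.

Lemma posdef_factor A : P A -> exists2 M, M \in unitmx & A = M *m M^T.
Proof.
case/posdef_spectral_exp => Q [d [QQ ->]].
exists (spectral_exp Q (2^-1 *: d)); first exact/posdef_unit/spectral_exp_posdef.
rewrite spectral_exp_tr spectral_expD // -scalerDl; have -> : 2^-1 + 2^-1 = 1 :> R by field.
by rewrite scale1r.
Qed.

Lemma tr_mulmx_tr_eq0 V : \tr (V *m V^T) = 0 -> V = 0.
Proof.
have ge0 i j : 0 <= V i j ^+ 2 by exact: sqr_ge0.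
have -> : \tr (V *m V^T) = \sum_i \sum_j V i j ^+ 2.
  by apply: eq_bigr => i _; rewrite mxE; apply: eq_bigr => j _; rewrite mxE.
move=> /eqP; rewrite psumr_eq0; last by move=> i _; exact: sumr_ge0.
move=> /allP h; apply/matrixP => i j; rewrite mxE; apply/eqP.
have := h i (mem_index_enum _); rewrite /= psumr_eq0 // => /allP /(_ j (mem_index_enum _)).
by rewrite /= sqrf_eq0.
Qed.

(** With A = M M^T, the number trace_metric A V V is the squared Frobenius norm
    of M^-1 V M^-T. *)
Lemma trace_metric_def A V : P A -> Symm R n V -> trace_metric A V V = 0 -> V = 0.
Proof.
case/posdef_factor => M uM -> /SymmE sV; rewrite /trace_metric.
have uMT : M^T \in unitmx by rewrite unitmx_tr.
pose N := invmx M.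
have -> : invmx (M *m M^T) = N^T *m N.
  apply: mulmx1_inv; rewrite /N mulmxA -[M *m M^T *m _]mulmxA -trmx_mul.
  by rewrite mulVmx // trmx1 mulmx1 mulmxV.
set Z := N *m V *m N^T => h.
have : Z = 0.
  apply: tr_mulmx_tr_eq0; rewrite -h /Z !trmx_mul trmxK sV mxtrace_mulC.
  by rewrite [RHS]mxtrace_mulC !mulmxA [RHS]mxtrace_mulC !mulmxA.
move=> Z0; have : M *m Z *m M^T = V.
  by rewrite /Z !mulmxA mulmxV // mul1mx -mulmxA -trmx_mul mulmxV // trmx1 mulmx1.
by rewrite Z0 mulmx0 mul0mx.
Qed.

Lemma posdef_coercive A : P A ->
  exists2 c : R, 0 < c & forall x : 'cV[R]_n, c * \sum_i x i 0 ^+ 2 <= qf A x.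
Proof.
case/posdef_spectral_exp => Q [d [QQ ->]].
(* Every eigenvalue is at least the inverse of the sum of all inverse
     eigenvalues; this avoids a minimum over a possibly empty index type. *)
pose s := \sum_i expR (- d 0 i).
have s_ge i : expR (- d 0 i) <= s.
  by rewrite /s (bigD1 i) //= lerDl sumr_ge0 // => j _; exact: expR_ge0.
exists (s + 1)^-1; first by rewrite invr_gt0 ltr_wpDl // sumr_ge0 // => i _; exact: expR_ge0.
move=> x; pose y := Q^T *m x.
have -> : \sum_i x i 0 ^+ 2 = \sum_i y i 0 ^+ 2.
  have E (z : 'cV[R]_n) : \sum_i z i 0 ^+ 2 = (z^T *m z) 0 0.
    by rewrite mxE; apply: eq_bigr => i _; rewrite mxE.
  by rewrite !E /y trmx_mul trmxK mulmxA -[x^T *m Q *m _]mulmxA QQ mulmx1.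
have -> : x^T *m spectral_exp Q d *m x = y^T *m diag_mx (map_mx expR d) *m y.
  by rewrite /y trmx_mul trmxK /spectral_exp !mulmxA.
rewrite qf_diag mulr_sumr; apply: ler_sum => i _; apply: ler_wpM2r; first exact: sqr_ge0.
rewrite mxE -[expR _]invrK -expRN lef_pV2 ?posrE ?expR_gt0 //.
  by rewrite (le_trans (s_ge i)) // lerDl.
by rewrite ltr_wpDl // sumr_ge0 // => j _; exact: expR_ge0.
Qed.

(** The cone is open in the space of symmetric matrices (not in the space of all
    matrices): by coercivity, a perturbation whose entries are small compared
    with the smallest eigenvalue cannot spoil positivity. *)
Lemma posdef_open A : P A -> \forall X \near A, Symm R n X -> P X.
Proof.
move=> PA; have [c c0 cA] := posdef_coercive PA.
pose e := c / n.+1%:R; have e0 : 0 < e by rewrite divr_gt0.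
have near_e : \forall X \near nbhs A, forall i j, `|A i j - (X : 'M[R]_n) i j| < e.
  apply: (@filter_forall _ _ (fun i (X : 'M[R]_n) => forall j, _)) => i.
  apply: (@filter_forall _ _ (fun j (X : 'M[R]_n) => _)) => j.
  have /cvgrPdist_lt /(_ e e0) := @coord_continuous R n n i j A.  exact.
apply: filterS near_e => X Xe sX; split => // x x0.
have sq0 := sumsq_gt0 x0; set q := \sum_i x i 0 ^+ 2 in sq0.
pose Y := X - A.
have -> : qf X x = qf A x + qf Y x.
  by rewrite (_ : X = A + Y) ?mulmxDr ?mulmxDl ?[LHS]mxE // /Y addrC subrK.
have Yb : - (e * n%:R * q) <= qf Y x.
  have -> : qf Y x = \sum_j \sum_i x i 0 * Y i j * x j 0.
    rewrite mxE; apply: eq_bigr => j _; rewrite mxE mulr_suml.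
    by apply: eq_bigr => i _; rewrite mxE.
  have -> : - (e * n%:R * q) = \sum_(j < n) \sum_(i < n) - (e * ((x i 0 ^+ 2 + x j 0 ^+ 2) / 2)).
    under eq_bigr do rewrite sumrN -mulr_sumr -mulr_suml big_split /= sumr_const card_ord.
    rewrite sumrN -mulr_sumr -mulr_suml big_split /= sumr_const card_ord.
    by rewrite -/q sumrMnl -/q -[q *+ n]mulr_natr; field.
  apply: ler_sum => j _; apply: ler_sum => i _.
  have := Xe i j; rewrite /= distrC => /ltW; rewrite ler_norml => /andP[h1 h2].
  have -> : Y i j = X i j - A i j by rewrite !mxE.
  set y := X i j - A i j in h1 h2 *.
  have := sqr_ge0 (x i 0 - x j 0); have := sqr_ge0 (x i 0 + x j 0).
  by nra.
apply: lt_le_trans (lerD (cA x) Yb); rewrite -/q -mulrBl mulr_gt0 //.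
rewrite subr_gt0 /e mulrAC ltr_pdivrMr ?ltr0n // ltr_pM2l // ltr_nat //.
Qed.

End PosDef.

(** * Linear maps that send rank one projectors to rank one projectors *)

Section Wigner.
Variables (R : realType) (n : nat).
Implicit Types (X Y Q V W : 'M[R]_n) (d : 'rV[R]_n) (x y u v : 'cV[R]_n).

Definition dot x y : R := (x^T *m y) 0 0.
Definition outer x : 'M[R]_n := x *m x^T.

Lemma dotE x y : dot x y = \sum_i x i 0 * y i 0.
Proof. by rewrite /dot mxE; apply: eq_bigr => i _; rewrite mxE. Qed.

Lemma dotC x y : dot x y = dot y x.
Proof. by rewrite !dotE; apply: eq_bigr => i _; rewrite mulrC. Qed.

Lemma dot_ge0 x : 0 <= dot x x.
Proof. by rewrite dotE sumr_ge0 // => i _; rewrite -expr2 sqr_ge0. Qed.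

Lemma dotxx_gt0 x : x != 0 -> 0 < dot x x.
Proof.
by move/sumsq_gt0; rewrite dotE; under eq_bigr do rewrite expr2.
Qed.

Lemma outerE x i j : outer x i j = x i 0 * x j 0.
Proof. by rewrite /outer mxE big_ord1 !mxE. Qed.

Lemma outer_sym x : Symm R n (outer x).
Proof. by apply/SymmE; rewrite /outer trmx_mul trmxK. Qed.

Lemma tr_outer x : \tr (outer x) = dot x x.
Proof. by rewrite dotE; apply: eq_bigr => i _; rewrite outerE. Qed.

Lemma tr_outerM x y : \tr (outer x *m outer y) = dot x y ^+ 2.
Proof.
rewrite expr2 dotE mulr_suml; apply: eq_bigr => i _.
rewrite mxE mulr_sumr; apply: eq_bigr => j _; rewrite !outerE; ring.
Qed.

(** Linearity is only demanded on symmetric matrices, because the differential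
    of a map of the positive cone is only meaningful there. *)
Record symm_linear (T : 'M[R]_n -> 'M[R]_n) : Prop := SymmLinear {
  sl_symm : forall V, Symm R n V -> Symm R n (T V);
  sl_add : forall V W, Symm R n V -> Symm R n W -> T (V + W) = T V + T W;
  sl_scale : forall k V, Symm R n V -> T (k *: V) = k *: T V }.

Lemma SymmD V W : Symm R n V -> Symm R n W -> Symm R n (V + W).
Proof. by move=> /SymmE sV /SymmE sW; apply/SymmE; rewrite linearD /= sV sW. Qed.

Lemma SymmZ k V : Symm R n V -> Symm R n (k *: V).
Proof. by move=> /SymmE sV; apply/SymmE; rewrite linearZ /= sV. Qed.

Lemma SymmB V W : Symm R n V -> Symm R n W -> Symm R n (V - W).
Proof. by move=> /SymmE sV /SymmE sW; apply/SymmE; rewrite raddfB /= sV sW. Qed.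

Lemma Symm0 : Symm R n 0.
Proof. by apply/SymmE; rewrite trmx0. Qed.

Lemma Symm1 : Symm R n 1%:M.
Proof. by apply/SymmE; rewrite trmx1. Qed.

Lemma SymmC Q V : Symm R n V -> Symm R n (Q *m V *m Q^T).
Proof. by move=> /SymmE sV; apply/SymmE; rewrite !trmx_mul trmxK sV mulmxA. Qed.

Lemma sl0 T : symm_linear T -> T 0 = 0.
Proof. by move=> lT; rewrite -(scale0r 0) (sl_scale lT) ?scale0r //; exact: Symm0. Qed.

Lemma slB T V W : symm_linear T -> Symm R n V -> Symm R n W -> T (V - W) = T V - T W.
Proof.
move=> lT sV sW; rewrite -[- W]scaleN1r -[- T W]scaleN1r.
by rewrite (sl_add lT sV (SymmZ (-1) sW)) (sl_scale lT _ sW).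
Qed.

Lemma sl_sum T (I : finType) (F : I -> 'M[R]_n) : symm_linear T ->
  (forall i, Symm R n (F i)) -> T (\sum_i F i) = \sum_i T (F i).
Proof.
move=> lT sF.
suff [] : Symm R n (\sum_i F i) /\ T (\sum_i F i) = \sum_i T (F i) by [].
apply: (big_ind2 (fun V W => Symm R n V /\ T V = W)).
- by split; [exact: Symm0 | exact: sl0].
- move=> V V' W W' [sV TV] [sW TW]; split; first exact: SymmD.
  by rewrite (sl_add lT) // TV TW.
- by move=> i _; split.
Qed.

Definition symdelta (i j : 'I_n) : 'M[R]_n := 2^-1 *: (delta_mx i j + delta_mx j i).

Lemma symdelta_sym i j : Symm R n (symdelta i j).
Proof. by apply/SymmE; rewrite /symdelta linearZ linearD /= !trmx_delta addrC. Qed.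

Lemma sym_decomp V : Symm R n V -> V = \sum_i \sum_j V i j *: symdelta i j.
Proof.
move=> /SymmE sV.
have VT : V = \sum_i \sum_j V i j *: delta_mx j i.
  rewrite -{1}sV {1}[V]matrix_sum_delta !raddf_sum.
  apply: eq_bigr => i _; rewrite raddf_sum; apply: eq_bigr => j _.
  by apply/matrixP => k l; rewrite !mxE andbC.
transitivity (2^-1 *: (V + V)).
  rewrite scalerDr -scalerDl (_ : 2^-1 + 2^-1 = 1 :> R) ?scale1r //; by field.
rewrite {1}VT {2}[V]matrix_sum_delta addrC -big_split scaler_sumr.
apply: eq_bigr => i _; rewrite -big_split scaler_sumr; apply: eq_bigr => j _.
by rewrite /= /symdelta -scalerDr !scalerA mulrC.
Qed.

(** Polarisation: symmetric matrices are spanned by the x x^T with x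
    entrywise nonnegative. *)
Lemma symdelta_outer i j : symdelta i j = 2^-1 *:
  (outer (delta_mx i 0 + delta_mx j 0) - outer (delta_mx i 0) - outer (delta_mx j 0)).
Proof.
congr (_ *: _); apply/matrixP => k l; rewrite !mxE !big_ord1 !mxE !eqxx !andbT.
by rewrite -!mulnb !natrM; ring.
Qed.

Lemma sym_span (T T' : 'M[R]_n -> 'M[R]_n) : symm_linear T -> symm_linear T' ->
  (forall x, (forall i, 0 <= x i 0) -> T (outer x) = T' (outer x)) ->
  forall V, Symm R n V -> T V = T' V.
Proof.
move=> lT lT' TT' V sV; rewrite (sym_decomp sV).
have sVS ij : Symm R n (V ij.1 ij.2 *: symdelta ij.1 ij.2) by exact/SymmZ/symdelta_sym.
rewrite pair_bigA /= (sl_sum lT sVS) (sl_sum lT' sVS); apply: eq_bigr => -[i j] _ /=.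
rewrite !(sl_scale lT _ (symdelta_sym _ _), sl_scale lT' _ (symdelta_sym _ _)).
congr (_ *: _); rewrite symdelta_outer.
have e_ge0 (p k : 'I_n) : 0 <= (delta_mx p 0 : 'cV[R]_n) k 0.
  by rewrite mxE; case: (_ && _).
have s1 := outer_sym; have s2 u v : Symm R n (outer u - outer v) by exact: SymmB.
have s3 u v w : Symm R n (outer u - outer v - outer w) by exact: SymmB.
rewrite (sl_scale lT _ (s3 _ _ _)) (sl_scale lT' _ (s3 _ _ _)).
rewrite (slB lT (s2 _ _) (s1 _)) (slB lT' (s2 _ _) (s1 _)) !(slB lT (s1 _) (s1 _)).
rewrite !(slB lT' (s1 _) (s1 _)) !TT' // => k.
by rewrite mxE addr_ge0.
Qed.

(** A linear version of Wigner's theorem. Writing T (x x^T) = u(x) u(x)^T,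
    the form gives (u(x) . u(y))^2 = (x . y)^2, so the u(e_i) are orthonormal.
    After rotating by them, the coordinates of u(x) are those of x up to sign; the
    signs for the all-ones vector are absorbed in the rotation. For entrywise
    nonnegative x, comparing the products with the all-ones vector shows that the
    coordinates of u(x) all have the same sign, so u(x) u(x)^T = x x^T, and these
    matrices span. *)
Theorem wigner T : symm_linear T ->
  (forall V W, Symm R n V -> Symm R n W -> \tr (T V *m T W) = \tr (V *m W)) ->
  (forall x, exists u, T (outer x) = outer u) ->
  exists2 Q, Q *m Q^T = 1%:M & forall V, Symm R n V -> T V = Q *m V *m Q^T.
Proof.
move=> lT gT hT; have [u uE] := choice hT.
have du x y : dot (u x) (u y) ^+ 2 = dot x y ^+ 2.
  by rewrite -!tr_outerM -!uE gT //; exact: outer_sym.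
pose e (i : 'I_n) : 'cV[R]_n := delta_mx i 0.
have dotel i x : dot (e i) x = x i 0.
  rewrite dotE (bigD1 i) //= big1 ?mxE ?eqxx ?mul1r ?addr0 // => j ji.
  by rewrite mxE (negbTE ji) mul0r.
pose U : 'M[R]_n := \matrix_(i, j) u (e j) i 0.
have UTu x i : (U^T *m u x) i 0 = dot (u (e i)) (u x).
  by rewrite dotE mxE; apply: eq_bigr => j _; rewrite !mxE.
have UU : U^T *m U = 1%:M.
  apply/matrixP => i j; rewrite mxE.
  transitivity (dot (u (e i)) (u (e j))).
    by rewrite dotE; apply: eq_bigr => k _; rewrite !mxE.
  have h := du (e i) (e j); rewrite dotel !mxE eqxx andbT in h.
  rewrite !mxE; case: eqVneq h => [<-|ij].
    rewrite expr1n => /eqP; rewrite sqrf_eq1 => /orP[/eqP //|/eqP h].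
    by have := dot_ge0 (u (e i)); rewrite h oppr_ge0 ler10.
  by move=> /eqP; rewrite expr0n sqrf_eq0 => /eqP.
pose one : 'cV[R]_n := const_mx 1.
(* z lists the signs acquired by the all-ones vector. *)
pose z : 'rV[R]_n := (U^T *m u one)^T.
have zE i : z 0 i = dot (u (e i)) (u one) by rewrite mxE UTu.
have zz i : z 0 i * z 0 i = 1.
  by rewrite zE -expr2 du dotel mxE expr1n.
have [Q Qdef] : exists Q, Q = U *m diag_mx z by eexists.
have QTE : Q^T = diag_mx z *m U^T by rewrite Qdef trmx_mul tr_diag_mx.
have QQ : Q *m Q^T = 1%:M.
  rewrite QTE Qdef mulmxA -[_ *m _ *m diag_mx z]mulmxA mulmx_diag.
  rewrite (_ : \row__ _ = const_mx 1); last by apply/rowP => i; rewrite !mxE -(zz i) !mxE.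
  by rewrite diag_const_mx mulmx1 (mulmx1C UU).
exists Q => //.
have lQ : symm_linear (fun V => Q *m V *m Q^T).
  split=> [V|V W _ _|k V _]; first exact: SymmC.
    by rewrite mulmxDr mulmxDl.
  by rewrite -scalemxAr -scalemxAl.
apply: sym_span => // x x0.
pose v x := Q^T *m u x.
have vE y i : v y i 0 = z 0 i * dot (u (e i)) (u y).
  by rewrite /v QTE -mulmxA mul_diag_mx mxE UTu.
have v1 i : v one i 0 = 1.
  by rewrite vE -zE zz.
have dv y y' : dot (v y) (v y') = dot (u y) (u y').
  by rewrite /dot /v trmx_mul trmxK mulmxA -[_ *m Q *m _]mulmxA QQ mulmx1.
have vx i : v x i 0 ^+ 2 = x i 0 ^+ 2.
  by rewrite vE exprMn du dotel expr2 zz mul1r.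
have vabs i : `|v x i 0| = x i 0.
  by apply/eqP; rewrite -(@eqrXn2 _ 2) // real_normK ?num_real // vx.
have s1 : (\sum_i v x i 0) ^+ 2 = (\sum_i x i 0) ^+ 2.
  have -> : \sum_i v x i 0 = dot (v one) (v x).
    by rewrite dotE; apply: eq_bigr => i _; rewrite v1 mul1r.
  by rewrite dv du dotE; congr (_ ^+ 2); apply: eq_bigr => i _; rewrite mxE mul1r.
(* The squared sums agree, and each term of their difference is nonnegative,
   so each term vanishes. *)
have term_ge0 i j : 0 <= x i 0 * x j 0 - v x i 0 * v x j 0.
  by rewrite subr_ge0 -!vabs -normrM ler_norm.
have : \sum_i \sum_j (x i 0 * x j 0 - v x i 0 * v x j 0) = 0.
  transitivity ((\sum_i x i 0) ^+ 2 - (\sum_i v x i 0) ^+ 2); last by rewrite s1 subrr.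
  rewrite !expr2 !mulr_suml -sumrB; apply: eq_bigr => i _.
  by rewrite !mulr_sumr -sumrB.
move=> /eqP; rewrite psumr_eq0; last by move=> i _; exact: sumr_ge0.
move=> /allP h.
have vv : outer (v x) = outer x.
  apply/matrixP => i j; rewrite !outerE; apply/eqP; rewrite eq_sym -subr_eq0.
  have := h i (mem_index_enum _); rewrite /= psumr_eq0 // => /allP.
  exact: (fun H => H j (mem_index_enum _)).
rewrite uE -vv /outer /v trmx_mul trmxK !mulmxA QQ mul1mx.
by rewrite -mulmxA QQ mulmx1.
Qed.

End Wigner.

(** * Linear maps that intertwine hyperbolic cosines *)

Section CoshMaps.
Variables (R : realType) (n : nat).
Implicit Types (X Y Z Q V W : 'M[R]_n) (d : 'rV[R]_n) (x y u v : 'cV[R]_n).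

Definition twocosh (t : R) : R := expR t + expR (- t).

(** With a = expR s and b = expR t, the difference of both sides is
    (a - b) (a b - 1) / (a b). *)
Lemma twocosh_eq (s t : R) : twocosh s = twocosh t -> s = t \/ s = - t.
Proof.
rewrite /twocosh !expRN => h.
have a0 := expR_gt0 s; have b0 := expR_gt0 t.
have : (expR s - expR t) * (expR s * expR t - 1) = 0.
  have an0 := lt0r_neq0 a0; have bn0 := lt0r_neq0 b0.
  have -> : (expR s - expR t) * (expR s * expR t - 1) =
    expR s * expR t * ((expR s + (expR s)^-1) - (expR t + (expR t)^-1)).
    by field; rewrite an0 bn0.
  by rewrite h subrr mulr0.
move=> /eqP; rewrite mulf_eq0 !subr_eq0 => /orP[/eqP/expR_inj|]; first by left.
rewrite -expRD -expR0 => /eqP/expR_inj/eqP; rewrite addr_eq0 => /eqP; by right.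
Qed.

(** The operator Y |-> B Y B^-1 + B^-1 Y B with B = exp D, D diagonal, acts
    on the entry (i, j) as multiplication by 2 cosh (d_i - d_j). *)
Definition hadamard_cosh d Z : 'M[R]_n :=
  \matrix_(i, j) (twocosh (d 0 i - d 0 j) * Z i j).

Lemma cosh_conj Q d Z : Q *m Q^T = 1%:M ->
  let Y := Q *m Z *m Q^T in
  spectral_exp Q d *m Y *m spectral_exp Q (- d) + spectral_exp Q (- d) *m Y *m spectral_exp Q d =
  Q *m hadamard_cosh d Z *m Q^T.
Proof.
move=> QQ Y; rewrite /spectral_exp /Y !ortho_conjM // -mulmxDl -mulmxDr.
congr (_ *m _ *m _); apply/matrixP => i j.
rewrite !mul_mx_diag !mul_diag_mx !mxE /twocosh opprB !expRD; ring.
Qed.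

(** The properties of the differential at the identity of a normalized isometry
    that are used to determine it: an isometry of the Frobenius form on symmetric
    matrices that intertwines the operators 2 cosh (ad X) and 2 cosh (ad T X). *)
Record cosh_map (T : 'M[R]_n -> 'M[R]_n) : Prop := CoshMap {
  cm_lin : symm_linear T;
  cm_form : forall V W, Symm R n V -> Symm R n W ->
    \tr (T V *m T W) = \tr (V *m W);
  cm_surj : forall V, Symm R n V -> exists2 U, Symm R n U & T U = V;
  cm_cosh : forall Q d Q' d', Q *m Q^T = 1%:M -> Q' *m Q'^T = 1%:M ->
    T (Q *m diag_mx d *m Q^T) = Q' *m diag_mx d' *m Q'^T ->
    forall Y, Symm R n Y ->
    T (spectral_exp Q d *m Y *m spectral_exp Q (- d) + spectral_exp Q (- d) *m Y *m spectral_exp Q d) =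
    spectral_exp Q' d' *m T Y *m spectral_exp Q' (- d') + spectral_exp Q' (- d') *m T Y *m spectral_exp Q' d' }.

(** Replacing T X by - T X replaces exp (T X) by its inverse, and 2 cosh is even. *)
Lemma cosh_map_opp T : cosh_map T -> cosh_map (fun V => - T V).
Proof.
case=> [[sT aT zT]] gT oT cT; split.
- split=> [V sV|V W sV sW|k V sV].
  + by rewrite -scaleN1r; exact/SymmZ/sT.
  + by rewrite aT // opprD.
  + by rewrite zT // scalerN.
- by move=> V W sV sW; rewrite mulNmx mulmxN opprK gT.
- move=> V sV; have [|U sU TU] := oT (- V); first by rewrite -scaleN1r; exact: SymmZ.
  by exists U => //; rewrite TU opprK.
- move=> Q d Q' d' QQ QQ' h Y sY; rewrite (cT Q d Q' (- d')) //.
    have oppE (A B : 'M[R]_n) W :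
        A *m - W *m B + B *m - W *m A = - (B *m W *m A + A *m W *m B).
      by rewrite !mulmxN !mulNmx opprD addrC.
    by rewrite opprK oppE.
  by rewrite -[LHS]opprK h raddfN /= mulmxN mulNmx.
Qed.

Section Fixed.
Variable T : 'M[R]_n -> 'M[R]_n.
Hypothesis cT : cosh_map T.

(** A quadratic polynomial that annihilates the operator 2 cosh (ad X) also
    annihilates 2 cosh (ad T X), because T conjugates one into the other. Its roots
    are then the only possible values of 2 cosh of the differences of eigenvalues. *)
Lemma cosh_spectrum Q d Q' d' (a b : R) :
  Q *m Q^T = 1%:M -> Q' *m Q'^T = 1%:M ->
  T (Q *m diag_mx d *m Q^T) = Q' *m diag_mx d' *m Q'^T ->
  (forall i j, (twocosh (d 0 i - d 0 j) - a) * (twocosh (d 0 i - d 0 j) - b) = 0) ->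
  forall i j, (twocosh (d' 0 i - d' 0 j) - a) * (twocosh (d' 0 i - d' 0 j) - b) = 0.
Proof.
move=> QQ QQ' hT hd i j; have lT := cm_lin cT.
have hsym (e : 'rV[R]_n) Z : Symm R n Z -> Symm R n (hadamard_cosh e Z).
  move=> /SymmE sZ; apply/SymmE/matrixP => k l.
  by rewrite !mxE -[in LHS]sZ mxE /twocosh !opprB addrC.
pose T' Z := Q'^T *m T (Q *m Z *m Q^T) *m Q'.
have T'E Z : T (Q *m Z *m Q^T) = Q' *m T' Z *m Q'^T.
  by rewrite /T' /= -!mulmxA ortho_mulmxK // !mulmxA mulmx_orthoK.
have T'h Z : Symm R n Z -> T' (hadamard_cosh d Z) = hadamard_cosh d' (T' Z).
  move=> sZ; have := cm_cosh cT QQ QQ' hT (SymmC Q sZ).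
  rewrite T'E !cosh_conj // T'E => /(congr1 (fun M => Q'^T *m M *m Q')) /=.
  rewrite -!mulmxA !ortho_mulmxTK // !(orthoC QQ') !mulmx1 => <-.
  by rewrite /T' -!mulmxA.
have sD : Symm R n (delta_mx i j + delta_mx j i).
  by apply/SymmE; rewrite linearD /= !trmx_delta addrC.
(* Test the polynomial on the preimage of a matrix whose (i, j) entry
   does not vanish. *)
have [U sU TU] := cm_surj cT (SymmC Q' sD).
have [Z Zdef] : exists Z, Z = Q^T *m U *m Q by eexists.
have sZ : Symm R n Z by rewrite Zdef -{2}[Q]trmxK; exact: SymmC.
have T'Z : T' Z = delta_mx i j + delta_mx j i.
  rewrite /T' Zdef -[Q^T *m U *m Q]mulmxA ortho_mulmxK // mulmx_orthoK // TU.
  by rewrite -!mulmxA ortho_mulmxTK // (orthoC QQ') mulmx1.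
have rel : hadamard_cosh d (hadamard_cosh d Z) - (a + b) *: hadamard_cosh d Z + (a * b) *: Z = 0.
  apply/matrixP => k l; rewrite !mxE.
  transitivity ((twocosh (d 0 k - d 0 l) - a) * (twocosh (d 0 k - d 0 l) - b) * Z k l).
    by ring.
  by rewrite hd mul0r.
have h1 := hsym d _ sZ; have h2 := hsym d _ h1.
have lT' : symm_linear T'.
  split=> [V sV|V W sV sW|k V sV]; rewrite /T'.
  - by rewrite -{2}[Q']trmxK; apply: SymmC; apply: (sl_symm lT); exact: SymmC.
  - by rewrite mulmxDr mulmxDl (sl_add lT) ?mulmxDr ?mulmxDl //; exact: SymmC.
  - by rewrite -scalemxAr -scalemxAl (sl_scale lT) -?scalemxAr -?scalemxAl //; exact: SymmC.
have := congr1 T' rel.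
rewrite (sl_add lT' (SymmB h2 (SymmZ _ h1)) (SymmZ _ sZ)).
rewrite (slB lT' h2 (SymmZ _ h1)) (sl_scale lT' _ h1) (sl_scale lT' _ sZ).
rewrite (sl0 lT') !T'h // T'Z => /matrixP /(_ i j).
rewrite !mxE !eqxx /= => h.
set t := twocosh _ in h *.
have c0 : 1 + ((i == j) && (j == i))%:R != 0 :> R by rewrite gt_eqF // ltr_wpDr.
apply/eqP; rewrite -(mulIr_eq0 _ (mulIf c0)); apply/eqP; rewrite -[RHS]h; ring.
Qed.

Hypothesis n_gt1 : (1 < n)%N.
Let n_gt0 : (0 < n)%N := ltnW n_gt1.

(** 2 cosh (ad 1) is scalar, hence so is 2 cosh (ad T 1): all eigenvalues of
    T 1 coincide. The form fixes their absolute value. *)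
Lemma cosh_map1 : T 1%:M = 1%:M \/ T 1%:M = - 1%:M.
Proof.
have [Q' [d' [QQ' TE]]] := symmetric_spectral ((SymmE _).1 (sl_symm (cm_lin cT) (Symm1 R n))).
have E1 : 1%:M *m (1%:M : 'M[R]_n)^T = 1%:M by rewrite trmx1 mulmx1.
have h : T (1%:M *m diag_mx (const_mx 1) *m 1%:M^T) = Q' *m diag_mx d' *m Q'^T.
  by rewrite diag_const_mx !mul1mx trmx1.
have dd i j : d' 0 i = d' 0 j.
  have := cosh_spectrum (a := twocosh 0) (b := twocosh 0) E1 QQ' h.
  have H0 (k l : 'I_n) : (twocosh ((const_mx 1 : 'rV[R]_n) 0 k - (const_mx 1 : 'rV[R]_n) 0 l) - twocosh 0) *
    (twocosh ((const_mx 1 : 'rV[R]_n) 0 k - (const_mx 1 : 'rV[R]_n) 0 l) - twocosh 0) = 0.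
    by rewrite !mxE !subrr mulr0.
  move=> /(_ H0 i j) /eqP; rewrite mulf_eq0 orbb subr_eq0 => /eqP /twocosh_eq.
  rewrite oppr0 => -[] /eqP; rewrite subr_eq0 => /eqP ->; reflexivity.
pose m := d' 0 (Ordinal n_gt0).
have TI : T 1%:M = m%:M.
  rewrite TE (_ : d' = const_mx m); last by apply/rowP => i; rewrite mxE; exact: dd.
  by rewrite diag_const_mx mul_mx_scalar -scalemxAl QQ' scalemx1.
have := cm_form cT (Symm1 R n) (Symm1 R n); rewrite TI mulmx1 mxtrace1 -scalar_mxM mxtrace_scalar.
have n0 : n%:R != 0 :> R by rewrite pnatr_eq0 -lt0n.
rewrite -[LHS]mulr_natr -[RHS]mul1r => /(mulIf n0)/eqP.
rewrite -expr2 sqrf_eq1 => /orP[]/eqP ->.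
  by left.
by right; rewrite raddfN.
Qed.

Hypothesis T1 : T 1%:M = 1%:M.

Lemma cosh_map_tr V : Symm R n V -> \tr (T V) = \tr V.
Proof.
by move=> sV; have := cm_form cT sV (Symm1 R n); rewrite T1 !mulmx1.
Qed.

(** For a rank one projector X the differences of eigenvalues are 0, 1 and - 1, so
    by cosh_spectrum the eigenvalues of T X lie in {a, a + 1} for some a. Let K be
    the multiplicity of a + 1. The traces of T X and of its square are known, and
    they force (K - 1) (n - K - 1) = 0: either T X is a rank one projector, or
    such a projector subtracted from a multiple of the identity. For n = 2 these
    cases coincide, hence the condition in the second case. *)
Lemma cosh_map_outer1 v : dot v v = 1 -> exists u,
  T (outer v) = outer u \/
  (2 < n)%N /\ T (outer v) = - outer u + (2 / n%:R)%:M.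
Proof.
move=> vv; have sP := outer_sym v; have lT := cm_lin cT.
have [Q [d [QQ PE]]] := symmetric_spectral ((SymmE _).1 sP).
have [Q' [d' [QQ' SE]]] := symmetric_spectral ((SymmE _).1 (sl_symm lT sP)).
have PP : outer v *m outer v = outer v.
  rewrite /outer mulmxA -[v *m v^T *m v]mulmxA [v^T *m v]mx11_scalar -/(dot v v) vv.
  by rewrite mulmx1.
have d01 i : d 0 i = 0 \/ d 0 i = 1.
  have : Q^T *m (outer v *m outer v) *m Q = Q^T *m outer v *m Q by rewrite PP.
  rewrite PE ortho_conjM // -!mulmxA !ortho_mulmxTK // !(orthoC QQ) !mulmx1.
  rewrite mulmx_diag => /matrixP /(_ i i); rewrite !mxE eqxx !mulr1n => /eqP.
  rewrite -subr_eq0 -{3}[d 0 i]mulr1 -mulrBr mulf_eq0 subr_eq0.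
  by case/orP => /eqP; [left|right].
have hT : T (Q *m diag_mx d *m Q^T) = Q' *m diag_mx d' *m Q'^T by rewrite -PE.
have dd i j : d' 0 i - d' 0 j = 0 \/ d' 0 i - d' 0 j = 1 \/ d' 0 i - d' 0 j = - 1.
  have := cosh_spectrum (a := twocosh 0) (b := twocosh 1) QQ QQ' hT.
  have H k l : (twocosh (d 0 k - d 0 l) - twocosh 0) * (twocosh (d 0 k - d 0 l) - twocosh 1) = 0.
    have e1 : twocosh (- 1) = twocosh 1 by rewrite /twocosh opprK addrC.
    by case: (d01 k) => ->; case: (d01 l) => ->;
      rewrite ?subrr ?sub0r ?subr0 ?e1 ?subrr ?mul0r ?mulr0.
  move=> /(_ H i j) /eqP; rewrite mulf_eq0 !subr_eq0 => /orP[]/eqP/twocosh_eq.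
    by rewrite oppr0 => -[->|->]; left.
  by case=> ->; right; [left|right].
have [a da] : exists a, forall i, d' 0 i = a \/ d' 0 i = a + 1.
  (* The base value a is the smallest eigenvalue. *)
  pose i0 := [arg min_(i < Ordinal n_gt0) d' 0 i]%O.
  exists (d' 0 i0) => i; rewrite /i0; case: arg_minP => // k _ /(_ i isT) le_ki.
  case: (dd i k) => [|[]] h; [left|right|left]; lra.
pose A : {set 'I_n} := finset (fun i => d' 0 i == a + 1).
pose K : R := #|A|%:R.
have dE i : d' 0 i = a + (i \in A)%:R.
  rewrite inE; case: (da i) => ->; last by rewrite eqxx.
  by rewrite -subr_eq0 opprD addrA subrr sub0r oppr_eq0 oner_eq0 addr0.
have sumA : \sum_i (i \in A)%:R = K :> R.
  rewrite /K -sum1_card natr_sum [RHS]big_mkcond.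
  by apply: eq_bigr => i _; case: (i \in A).
have trS : n%:R * a + K = 1.
  have := cosh_map_tr sP; rewrite tr_outer vv SE mxtrace_mulC ortho_mulmxTK //.
  rewrite mxtrace_diag; under eq_bigr do rewrite dE.
  by rewrite big_split /= sumA sumr_const card_ord mulr_natl.
have trSS : n%:R * a ^+ 2 + (2 * a + 1) * K = 1.
  have := cm_form cT sP sP; rewrite tr_outerM vv expr1n SE ortho_conjM // mxtrace_mulC.
  rewrite ortho_mulmxTK // mulmx_diag mxtrace_diag => h; rewrite -[RHS]h.
  rewrite mulr_natl -{1}(card_ord n) -sumr_const -sumA mulr_sumr -big_split /=.
  apply: eq_bigr => i _; rewrite mxE dE; case: (i \in A) => /=; ring.
have n0 : n%:R != 0 :> R by rewrite pnatr_eq0 -lt0n.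
have KK : (K - 1) * (n%:R - K - 1) = 0.
  have -> : (K - 1) * (n%:R - K - 1) = n%:R * (n%:R * a ^+ 2 + (2 * a + 1) * K - 1)
     - (n%:R * a + K - 1) * (n%:R * a + K + 1) by ring.
  by rewrite trS trSS !subrr mulr0 mul0r subrr.
have SAE (i0 : 'I_n) : outer (Q' *m delta_mx i0 0) = Q' *m delta_mx i0 i0 *m Q'^T.
  by rewrite /outer trmx_mul trmx_delta mulmxA -[_ *m delta_mx i0 0 *m _]mulmxA mul_delta_mx.
have scalC (c : R) : Q' *m c%:M *m Q'^T = c%:M.
  by rewrite mul_mx_scalar -scalemxAl QQ' scalemx1.
have deltaE (i j i0 : 'I_n) :
    ((i == i0) && (j == i0))%:R = (i == i0)%:R *+ (i == j) :> R.
  case: (eqVneq i j) => [<-|ij]; first by rewrite andbb mulr1n.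
  by rewrite mulr0n; case: (eqVneq i i0) ij => //= ->; rewrite eq_sym => /negbTE ->.
have [K1|K1] := eqVneq K 1.
  have /eqP/cards1P [i0 A0] : #|A| = 1%N by apply/eqP; rewrite -(eqr_nat R) -/K K1.
  have a0 : a = 0.
    by apply: (mulfI n0); rewrite mulr0; apply: (addIr K); rewrite trS add0r K1.
  exists (Q' *m delta_mx i0 0); left; rewrite SAE SE; congr (_ *m _ *m _).
  by apply/matrixP => i j; rewrite !mxE dE a0 add0r A0 inE deltaE.
have Kn : n%:R - K = 1.
  move/eqP: KK; rewrite mulf_eq0 subr_eq0 (negbTE K1) /= subr_eq0 => /eqP //.
have cA : #|~: A| = 1%N.
  have : #|A|%:R + #|~: A|%:R = n%:R :> R by rewrite -natrD cardsC card_ord.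
  rewrite -/K => h; apply/eqP; rewrite -(eqr_nat R); apply/eqP; move: h Kn; lra.
have /eqP/cards1P [i0 A0] := cA.
have n2 : (2 < n)%N.
  rewrite ltn_neqAle n_gt1 andbT eq_sym; apply: contra K1 => /eqP n2.
  by move: Kn; rewrite n2 => h; apply/eqP; lra.
exists (Q' *m delta_mx i0 0); right; split => //; rewrite SAE SE.
have a1 : a + 1 = 2 / n%:R.
  apply: (mulfI n0); rewrite mulrCA divff // mulr1 mulrDr mulr1.
  by move: trS Kn; lra.
rewrite -(scalC (2 / n%:R)) -a1 -mulNmx -mulmxN -mulmxDl -mulmxDr; congr (_ *m _ *m _).
apply/matrixP => i j; rewrite !mxE dE.
have -> : (i \in A) = (i != i0) by rewrite -finset.in_set1 -A0 finset.in_setC negbK.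
by rewrite deltaE; case: eqVneq => _ /=; case: eqVneq => _ /=; rewrite ?mulr1n ?mulr0n; ring.
Qed.

End Fixed.
End CoshMaps.

(** * Classification of the differential at the identity *)

Section Classification.
Variables (R : realType) (n : nat).
Implicit Types (V W Q : 'M[R]_n) (x y u v : 'cV[R]_n).
Hypothesis n_gt1 : (1 < n)%N.

Let n0 : n%:R != 0 :> R.
Proof. by rewrite pnatr_eq0 -lt0n ltnW. Qed.

Lemma outerZ (k : R) x : outer (k *: x) = k ^+ 2 *: outer x.
Proof. by rewrite /outer linearZ /= -scalemxAl -scalemxAr scalerA. Qed.

Lemma outerN x : outer (- x) = outer x.
Proof. by rewrite -scaleN1r outerZ sqrrN expr1n scale1r. Qed.

Lemma outer0 : outer (0 : 'cV[R]_n) = 0.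
Proof. by rewrite /outer mul0mx. Qed.

Lemma dotDl x y z : dot (x + y) z = dot x z + dot y z.
Proof. by rewrite !dotE -big_split; apply: eq_bigr => i _; rewrite mxE mulrDl. Qed.

Lemma dotZl (k : R) x y : dot (k *: x) y = k * dot x y.
Proof. by rewrite !dotE mulr_sumr; apply: eq_bigr => i _; rewrite mxE mulrA. Qed.

Lemma dotDr x y z : dot z (x + y) = dot z x + dot z y.
Proof. by rewrite dotC dotDl !(dotC z). Qed.

Lemma dotZr (k : R) x y : dot x (k *: y) = k * dot x y.
Proof. by rewrite dotC dotZl dotC. Qed.

Section Fixed.
Variable T : 'M[R]_n -> 'M[R]_n.
Hypotheses (cT : cosh_map T) (T1 : T 1%:M = 1%:M).

(** The trace forces u to have the norm of x. *)
Definition rank1_image x := exists u, T (outer x) = outer u.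
(** The image of x x^T under T is that of some u u^T under the map
    X |-> - X + (2 / n) (tr X) 1, the differential at the identity of the inversion
    composed with the determinant scaling. *)
Definition reflected_image x := exists u, T (outer x) = - outer u + (2 * dot x x / n%:R)%:M.

Lemma unit_scaling x : x != 0 -> exists k v, [/\ k != 0, x = k *: v & dot v v = 1].
Proof.
move=> /dotxx_gt0 x0; have k0 : Num.sqrt (dot x x) != 0 by rewrite gt_eqF // sqrtr_gt0.
exists (Num.sqrt (dot x x)), ((Num.sqrt (dot x x))^-1 *: x); split => //.
  by rewrite scalerA divff // scale1r.
rewrite dotZl dotZr mulrA -invfM -expr2 sqr_sqrtr ?ltW // mulVf //.
by rewrite gt_eqF.
Qed.

Lemma rank1_imageZ (k : R) x : rank1_image x -> rank1_image (k *: x).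
Proof.
case=> u Tu; exists (k *: u).
by rewrite !outerZ (sl_scale (cm_lin cT)) ?Tu //; exact: outer_sym.
Qed.

Lemma rank1_or_reflected x : rank1_image x \/ (2 < n)%N /\ reflected_image x.
Proof.
have [->|x0] := eqVneq x 0.
  by left; exists 0; rewrite outer0 (sl0 (cm_lin cT)).
have [k [v [k0 -> vv]]] := unit_scaling x0.
have [u [Tu|[n2 Tu]]] := cosh_map_outer1 cT n_gt1 T1 vv.
  by left; apply: rank1_imageZ; exists u.
right; split=> //; exists (k *: u).
rewrite !outerZ (sl_scale (cm_lin cT) _ (outer_sym v)) Tu dotZl dotZr vv mulr1.
by rewrite scalerDr scalerN scale_scalar_mx; congr (_ + _%:M); field.
Qed.

(** If x had the first type and y the second one, then the form would give
    (x . y)^2 = - (u . z)^2 + (2 / n) |x|^2 |y|^2, so x and y cannot be close to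
    parallel; n is at least 3 in the second case. *)
Lemma rank1_image_step x y : 2 * (dot x x * dot y y) < 3 * dot x y ^+ 2 -> rank1_image x -> rank1_image y.
Proof.
move=> h [u Tu]; case: (rank1_or_reflected y) => // -[n2 [z Tz]].
have uu : dot u u = dot x x.
  by rewrite -!tr_outer -Tu (cosh_map_tr cT) //; exact: outer_sym.
have := cm_form cT (outer_sym x) (outer_sym y).
rewrite Tu Tz mulmxDr mulmxN mxtraceD raddfN /= !tr_outerM.
rewrite mul_mx_scalar mxtraceZ tr_outer uu => e.
have n3 : 3 <= n%:R :> R by rewrite ler_nat.
have : dot x y ^+ 2 * n%:R <= 2 * (dot x x * dot y y).
  have -> : 2 * (dot x x * dot y y) = (2 * dot y y / n%:R * dot x x) * n%:R by field.
  by rewrite ler_wpM2r // -e; have := sqr_ge0 (dot u z); lra.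
have := sqr_ge0 (dot x y); nra.
Qed.

(** The angle between x and x + y is at most 45 degrees, which is too large for
    rank1_image_step, but 2 x + y lies in between. *)
Lemma rank1_image_half x y : dot x x = 1 -> dot y y = 1 -> 0 <= dot x y ->
  (rank1_image x -> rank1_image (x + y)) /\ (rank1_image (x + y) -> rank1_image x).
Proof.
move=> xx yy c0; set c := dot x y in c0.
have yx : dot y x = c by rewrite dotC.
pose w := 2 *: x + y.
have xw : dot x w = 2 + c by rewrite /w dotDr dotZr xx mulr1.
have ww : dot w w = 5 + 4 * c.
  by rewrite /w !(dotDr, dotDl, dotZr, dotZl) xx yy yx -/c; ring.
have ws : dot w (x + y) = 3 + 3 * c.
  by rewrite /w !(dotDr, dotDl, dotZr, dotZl) xx yy yx -/c; ring.
have ss : dot (x + y) (x + y) = 2 + 2 * c.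
  by rewrite !(dotDr, dotDl, dotZr, dotZl) xx yy yx -/c; ring.
by split=> [/(@rank1_image_step _ w)|/(@rank1_image_step _ w)] h; (apply: rank1_image_step; last (apply: h));
  rewrite ?(dotC _ w) ?[dot w x]dotC ?xx ?xw ?ww ?ws ?ss; nra.
Qed.

(** Since x and - x have the same type, the angle between x and y may be assumed
    to be at most 90 degrees; pass through the bisector. *)
Lemma rank1_image_transfer x y : x != 0 -> y != 0 -> rank1_image x -> rank1_image y.
Proof.
move=> x0 y0.
have [k [v [k0 -> vv]]] := unit_scaling x0.
have [l [w [l0 -> ww]]] := unit_scaling y0.
move=> /(rank1_imageZ k^-1); rewrite scalerA mulVf // scale1r => pv.
apply: rank1_imageZ.
have key z : dot z z = 1 -> 0 <= dot v z -> rank1_image z.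
  move=> zz vz; have [h1 _] := rank1_image_half vv zz vz.
  have [|_ h2] := rank1_image_half zz vv; first by rewrite dotC.
  by apply: h2; rewrite addrC; exact: h1.
case: (leP 0 (dot v w)) => [|vw]; first exact: key.
have : rank1_image (- w).
  apply: key; first by rewrite -scaleN1r dotZl dotZr ww mulrA mulrNN !mulr1.
  by rewrite -scaleN1r dotZr mulN1r oppr_ge0 ltW.
by rewrite /rank1_image outerN.
Qed.

(** The type is the same for all vectors. If it is the second one, composing T
    with the corresponding involution reduces to the first one. *)
Lemma cosh_map_fixed : exists2 Q, Q *m Q^T = 1%:M &
  (forall V, Symm R n V -> T V = Q *m V *m Q^T) \/
  (forall V, Symm R n V -> T V = - (Q *m V *m Q^T) + (2 / n%:R * \tr V)%:M).
Proof.
have lT := cm_lin cT.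
have [all_plus|/existsNP[y ny]] := pselect (forall x, rank1_image x).
  by have [Q QQ hQ] := wigner lT (cm_form cT) all_plus; exists Q => //; left.
have y0 : y != 0.
  by apply/eqP => y0; apply: ny; exists 0; rewrite y0 outer0 (sl0 lT).
have all_minus x : reflected_image x.
  have [->|x0] := eqVneq x 0.
    exists 0; rewrite outer0 (sl0 lT) oppr0 add0r dotE big1 ?mulr0 ?mul0r ?raddf0 //.
    by move=> i _; rewrite mxE mul0r.
  by case: (rank1_or_reflected x) => [/(rank1_image_transfer x0 y0)|[]].
pose T' V := - T V + (2 / n%:R * \tr V)%:M.
have lT' : symm_linear T'.
  split=> [V sV|V W sV sW|k V sV]; rewrite /T'.
  - apply: SymmD; first by rewrite -scaleN1r; apply/SymmZ/(sl_symm lT).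
    by apply/SymmE; rewrite tr_scalar_mx.
  - by rewrite (sl_add lT) // mxtraceD mulrDr opprD raddfD /= addrACA.
  - by rewrite (sl_scale lT) // mxtraceZ scalerDr scalerN scale_scalar_mx mulrCA.
have [||Q QQ hQ] := wigner lT'.
- move=> V W sV sW; rewrite /T' mulmxDr !mulmxDl !mulmxN !mulNmx opprK.
  rewrite !mul_scalar_mx !mul_mx_scalar -?scalerN !raddfD /= !mxtraceZ !raddfN /=.
  rewrite (cm_form cT) // !(cosh_map_tr cT) // mxtrace_scalar -mulr_natr.
  by field.
- move=> x; have [u Tu] := all_minus x; exists u; rewrite /T' Tu tr_outer opprD opprK.
  by rewrite mulrAC subrK.
exists Q => //; right=> V sV; rewrite -hQ // /T' opprD opprK subrK //.
Qed.

End Fixed.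

(** The four cases of the theorem, on the level of differentials: the signs e = 1
    and e = - 1 stand for absence and presence of the inversion, and k <> 0 for
    the presence of the determinant scaling. *)
Theorem cosh_map_classification T : cosh_map T -> exists Q e k,
  [/\ Q *m Q^T = 1%:M, e = 1 \/ e = -1, k = 0 \/ k = - (2 * e) / n%:R &
      forall V, Symm R n V -> T V = Q *m (e *: V + (k * \tr V)%:M) *m Q^T].
Proof.
move=> cT.
have scalC Q (c : R) : Q *m Q^T = 1%:M -> Q *m c%:M *m Q^T = c%:M.
  by move=> QQ; rewrite mul_mx_scalar -scalemxAl QQ scalemx1.
have [s s1 [cT' T1]] : exists2 s : R, s = 1 \/ s = - 1 &
    cosh_map (fun V => s *: T V) /\ s *: T 1%:M = 1%:M.
  case: (cosh_map1 cT n_gt1) => T1.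
    exists 1; first by left.
    by split; rewrite ?T1 ?scale1r //; under eq_fun do rewrite scale1r.
  exists (-1); first by right.
  split; last by rewrite T1 scaleN1r opprK.
  by under eq_fun do rewrite scaleN1r; exact: cosh_map_opp.
have ss : s * s = 1 by case: s1 => ->; rewrite ?mulrNN mulr1.
have [Q QQ hQ] := cosh_map_fixed cT' T1.
have TE V : T V = s *: (s *: T V) by rewrite scalerA ss scale1r.
case: hQ => hQ.
  exists Q, s, 0; split => //; first by left.
  by move=> V sV; rewrite TE hQ // mul0r raddf0 addr0 -scalemxAr -scalemxAl.
exists Q, (- s), (2 * s / n%:R); split => //.
- by case: s1 => ->; [right|left; rewrite opprK].
- by right; rewrite mulrN opprK.
move=> V sV; rewrite TE hQ // mulmxDr mulmxDl scalC // scalerDr scale_scalar_mx.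
rewrite -scalemxAr -scalemxAl scalerN scaleNr; congr (_ + _%:M).
by field.
Qed.

End Classification.

(** * Derivatives of matrix-valued functions *)

Section Calculus.
Variable R : realType.

(** Directional derivatives are derivatives of curves, so that all the
    calculus below can be done for functions of a real variable. *)
Lemma is_derive_lineP (V W : normedModType R) (f : V -> W) a v D :
  is_derive a v f D <-> is_derive (0 : R) 1 (fun h : R => f (h *: v + a)) D.
Proof.
have E : (fun h : R => h^-1 *: (f (h *: v + a) - f a)) =
    (fun h : R => h^-1 *: ((fun h : R => f (h *: v + a)) (h *: 1 + 0) - f (0 *: v + a))).
  by apply/funext => h; rewrite scale0r add0r addr0 [_%:A]mulr1.
split=> -[h1 h2]; split.
- by move: h1; rewrite /derivable E.
- by move: h2; rewrite /derive /= E.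
- by rewrite /derivable E.
- by rewrite /derive /= E.
Qed.

Lemma is_derive_lineP_at (V W : normedModType R) (f : V -> W) a v D (t : R) :
  is_derive (t *: v + a) v f D -> is_derive t 1 (fun h : R => f (h *: v + a)) D.
Proof.
have E : (fun h : R => h^-1 *: (f (h *: v + (t *: v + a)) - f (t *: v + a))) =
    (fun h : R => h^-1 *: ((fun h : R => f (h *: v + a)) (h *: 1 + t) - f (t *: v + a))).
  by apply/funext => h; rewrite [_%:A]mulr1 scalerDl addrA.
by case=> h1 h2; split; [rewrite /derivable -E | rewrite /derive /= -E].
Qed.

Lemma is_derive_mxP (V : normedModType R) m n (M : V -> 'M[R]_(m, n)) t v D :
  is_derive t v M D <-> forall i j, is_derive t v (fun x => M x i j) (D i j).
Proof.
split=> [[dM <-] i j|h].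
  split; first by have /derivable_mxP := dM; apply.
  by rewrite derive_mx // mxE.
have dM : derivable M t v by apply/derivable_mxP => i j; have [] := h i j.
split=> //; rewrite derive_mx //; apply/matrixP => i j; rewrite mxE.
by have [] := h i j.
Qed.

Lemma is_derive_unique (V W : normedModType R) (f : V -> W) a v D D' :
  is_derive a v f D -> is_derive a v f D' -> D = D'.
Proof. by move=> [_ <-] [_ <-]. Qed.

Lemma is_derive_sumf (V W : normedModType R) (I : finType) (f : I -> V -> W) a v D :
  (forall i, is_derive a v (f i) (D i)) ->
  is_derive a v (fun x => \sum_i f i x) (\sum_i D i).
Proof.
move=> h; elim: (index_enum I) => [|i s IH].
  rewrite big_nil; under eq_fun do rewrite big_nil; exact: is_derive_cst.
rewrite big_cons; under eq_fun do rewrite big_cons.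
exact: (is_deriveD (h i) IH).
Qed.

Lemma is_derive_mulf (V : normedModType R) (f g : V -> R) a v df dg :
  is_derive a v f df -> is_derive a v g dg ->
  is_derive a v (fun x => f x * g x) (df * g a + f a * dg).
Proof.
move=> hf hg; apply: is_derive_eq (is_deriveM hf hg) _.
by rewrite addrC [_ *: _]mulrC; congr (_ + _).
Qed.

Section Curves.
Variables (V : normedModType R) (a v : V).

Lemma is_derive_mulmx m n p (M : V -> 'M[R]_(m, n)) (N : V -> 'M[R]_(n, p)) M' N' :
  is_derive a v M M' -> is_derive a v N N' ->
  is_derive a v (fun x => M x *m N x) (M' *m N a + M a *m N').
Proof.
move=> /is_derive_mxP hM /is_derive_mxP hN; apply/is_derive_mxP => i j.
rewrite !mxE -big_split /=.
have -> : (fun x => (M x *m N x) i j) = (fun x => \sum_k M x i k * N x k j).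
  by apply/funext => x; rewrite mxE.
by apply: is_derive_sumf => k; exact: is_derive_mulf.
Qed.

Lemma is_derive_mxtrace n (M : V -> 'M[R]_n) M' :
  is_derive a v M M' -> is_derive a v (fun x => \tr (M x)) (\tr M').
Proof. by move=> /is_derive_mxP hM; apply: is_derive_sumf => i; exact: hM. Qed.

Lemma is_derive_lmulmx m n p (A : 'M[R]_(m, n)) (N : V -> 'M[R]_(n, p)) N' :
  is_derive a v N N' -> is_derive a v (fun x => A *m N x) (A *m N').
Proof.
move=> hN; have := is_derive_mulmx (is_derive_cst A a v) hN.
by rewrite mul0mx add0r.
Qed.

Lemma is_derive_rmulmx m n p (A : 'M[R]_(n, p)) (N : V -> 'M[R]_(m, n)) N' :
  is_derive a v N N' -> is_derive a v (fun x => N x *m A) (N' *m A).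
Proof.
move=> hN; have := is_derive_mulmx hN (is_derive_cst A a v).
by rewrite mulmx0 addr0.
Qed.

Lemma derivable_prodf (I : finType) (f : I -> V -> R) :
  (forall i, derivable (f i) a v) -> derivable (fun x => \prod_i f i x) a v.
Proof.
move=> h; elim: (index_enum I) => [|i s IH].
  under eq_fun do rewrite big_nil; exact: (@derivable_cst R V R^o 1 a v).
under eq_fun do rewrite big_cons.
exact: (derivableM (h i) IH).
Qed.

Lemma derivable_det n (M : V -> 'M[R]_n) :
  (forall i j, derivable (fun x => M x i j) a v) ->
  derivable (fun x => \det (M x)) a v.
Proof.
move=> h.
suff [] : is_derive a v (fun x => \sum_(s : 'S_n) (-1) ^+ s * \prod_i M x i (s i))
  (\sum_(s : 'S_n) 'D_v (fun x => (-1) ^+ s * \prod_i M x i (s i)) a) by [].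
apply: is_derive_sumf => s; apply/derivableP.
have hp : derivable (fun x => \prod_i M x i (s i)) a v.
  by apply: (@derivable_prodf _ (fun i x => M x i (s i))) => i; exact: h.
apply: (@derivableM _ _ (fun=> _) _ _ _ _ hp).
exact: (@derivable_cst R V R^o).
Qed.

(** Cofactors are polynomials in the entries. *)
Lemma derivable_adj n (M : V -> 'M[R]_n) : derivable M a v ->
  derivable (fun x => \adj (M x)) a v.
Proof.
move=> /derivable_mxP h; apply/derivable_mxP => i j.
have -> : (fun x => (\adj (M x)) i j) = (fun x => (-1) ^+ (j + i) *: \det (row' j (col' i (M x)))).
  by apply/funext => x; rewrite mxE.
apply: derivableZ; apply: derivable_det => k l.
by under eq_fun do rewrite !mxE; exact: h.
Qed.

End Curves.

Lemma is_derive1_continuous (W : normedModType R) (c : R -> W) (t : R) c' :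
  is_derive t 1 c c' -> {for t, continuous c}.
Proof. by case=> /derivable1_diffP /differentiable_continuous. Qed.

(** Derivability comes from the cofactor formula, and the value from
    differentiating c * c^-1 = 1. *)
Lemma is_derive_invmx n (c : R -> 'M[R]_n) (t : R) c' : c t \in unitmx ->
  is_derive t 1 c c' ->
  is_derive t 1 (fun s => invmx (c s)) (- (invmx (c t) *m c' *m invmx (c t))).
Proof.
move=> ut hc.
have hdet : derivable (fun s => \det (c s)) t 1.
  by apply: derivable_det; apply/derivable_mxP; case: hc.
have det0 : \det (c t) != 0 by rewrite -unitfE -unitmxE.
have near_unit : \forall s \near t, c s \in unitmx.
  have hcont : (fun s => \det (c s)) @ t --> \det (c t).
    exact: is_derive1_continuous (derivableP hdet).
  have near0 := cvgr_neq0 _ hcont det0; near=> s.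
  by rewrite unitmxE unitfE; near: s; exact: near0.
have dinv : derivable (fun s => invmx (c s)) t 1.
  apply: (@near_eq_derivable _ _ _ (fun s => (\det (c s))^-1 *: \adj (c s))).
    by apply: filterS near_unit => s us; rewrite /invmx us.
  have /derivable_mxP hadj : derivable (fun s => \adj (c s)) t 1 by apply: derivable_adj; case: hc.
  apply/derivable_mxP => i j; under eq_fun do rewrite mxE.
  by apply: derivableM; [exact: derivableV | exact: hadj].
split=> //; set D := 'D_1 _ t.
have h1 : is_derive t 1 (fun s => c s *m invmx (c s)) (c' *m invmx (c t) + c t *m D).
  exact: is_derive_mulmx hc (derivableP dinv).
have h2 : is_derive t 1 (fun s => c s *m invmx (c s)) 0.
  have h3 := is_derive_cst (1%:M : 'M[R]_n) t 1.
  apply: near_eq_is_derive h3.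
  by apply: filterS near_unit => s us; rewrite mulmxV.
have := is_derive_unique h1 h2 => /eqP; rewrite addrC addr_eq0 => /eqP e.
by rewrite -[D](mulKmx ut) e mulmxN mulmxA.
Unshelve. all: by end_near. Qed.

Lemma is_derive0_cst n (c : R -> 'M[R]_n) :
  (forall t : R, is_derive t 1 c 0) -> forall s t, c s = c t.
Proof.
move=> h s t; apply/matrixP => i j.
apply: (@is_derive_0_is_cst R (fun s => c s i j)) => x.
by have /is_derive_mxP /(_ i j) := h x; rewrite mxE.
Qed.

End Calculus.

(** * Continuously differentiable functions on the positive cone *)

Section ContinuouslyDifferentiable.
Variables (R : realType) (n : nat).
Implicit Types (a b u v w x : 'M[R]_n) (f g : 'M[R]_n -> R).

Local Notation P := (posdefmx R n).

Definition cont_posdef g := forall a, P a -> forall e : R, 0 < e ->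
  \forall x \near a, P x -> `|g a - g x| < e.

(** Existence and continuity of the derivatives in each fixed symmetric
    direction. Linearity in the direction and the chain rule are consequences, proved
    below from the mean value theorem on segments of the convex cone. *)
Definition C1 f := forall v, Symm R n v ->
  (forall a, P a -> derivable f a v) /\ cont_posdef (fun a => 'D_v f a).

Lemma near_plane a u v (Q : 'M[R]_n -> Prop) : (\forall x \near a, Q x) ->
  exists2 d : R, 0 < d & forall s t : R, `|s| < d -> `|t| < d -> Q (s *: u + t *: v + a).
Proof.
move=> /nbhs_ballP [e /= e0 h].
pose k := `|u| + `|v| + 1; have k0 : 0 < k by rewrite ltr_wpDl // addr_ge0.
exists (e / k); first exact: divr_gt0.
move=> s t sd td; apply: h; rewrite -ball_normE /= opprD addrCA subrr addr0 normrN.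
apply: le_lt_trans (ler_normD _ _) _; rewrite !normrZ.
have h1 : `|s| * `|u| <= e / k * `|u| by rewrite ler_wpM2r // ltW.
have h2 : `|t| * `|v| <= e / k * `|v| by rewrite ler_wpM2r // ltW.
apply: le_lt_trans (lerD h1 h2) _; rewrite -mulrDr mulrAC ltr_pdivrMr // ltr_pM2l //.
by rewrite ltrDl.
Qed.

Lemma near_line a u (Q : 'M[R]_n -> Prop) : (\forall x \near a, Q x) ->
  \forall h \near (0 : R), Q (h *: u + a).
Proof.
move=> /(near_plane u 0) [d d0 hd].
apply: filterS (pseudometric_normed_Zmodule.nbhs0_lt d0) => h hlt.
by have := hd h 0; rewrite scaler0 addr0; apply; rewrite ?normr0.
Qed.

Lemma posdef_line a u : P a -> Symm R n u -> \forall h \near (0 : R), P (h *: u + a).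
Proof.
move=> Pa su; apply: filterS (near_line u (posdef_open Pa)) => h; apply.
by apply: SymmD; [exact: SymmZ | case: Pa].
Qed.

Lemma is_derive_dirZ f a v (k D : R) :
  is_derive a v f D -> is_derive a (k *: v) f (k * D).
Proof.
move=> /is_derive_lineP h; apply/is_derive_lineP.
pose phi (h : R) := f (h *: v + a).
have h0 : is_derive (0 * k) 1 phi D by rewrite mul0r.
have hk : is_derive (0 : R) 1 (fun h : R => h * k) k.
  apply: is_derive_eq (is_deriveM (is_derive_id _ _) (is_derive_cst k _ _)) _.
  by rewrite /= scaler0 add0r [_ *: _]mulr1.
have := @is_derive1_comp R phi (fun h : R => h * k) 0 D k h0 hk; rewrite mulrC.
by rewrite (_ : phi \o _ = fun h => f (h *: (k *: v) + a)) //; apply/funext => t /=; rewrite /phi scalerA.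
Qed.

Lemma mvt_unit (phi dphi : R -> R) :
  (forall t : R, 0 <= t <= 1 -> is_derive t 1 phi (dphi t)) ->
  exists2 t : R, 0 <= t <= 1 & phi 1 - phi 0 = dphi t.
Proof.
move=> h; have [||t] := @MVT R phi dphi 0 1 ltr01.
- by move=> x; rewrite in_itv /= => /andP[x0 x1]; apply: h; rewrite !ltW.
- apply: derivable_within_continuous => x; rewrite in_itv /= => hx.
  by have [] := h x hx.
rewrite in_itv /= => /andP[t0 t1]; rewrite subr0 mulr1 => e.
by exists t; rewrite // !ltW.
Qed.

Lemma mvt_segment f a b : P a -> P b ->
  (forall x, P x -> derivable f x (b - a)) ->
  exists2 t : R, 0 <= t <= 1 & f b - f a = 'D_(b - a) f (t *: (b - a) + a).
Proof.
move=> Pa Pb df.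
have [t t01 e] := @mvt_unit (fun t => f (t *: (b - a) + a))
    (fun t => 'D_(b - a) f (t *: (b - a) + a)) (fun t t01 =>
     is_derive_lineP_at (derivableP (df _ (posdef_convex Pa Pb t01)))).
by exists t => //; rewrite -e scale1r subrK scale0r add0r.
Qed.

Lemma derivable_dirZ f a v (k : R) : derivable f a v -> 'D_(k *: v) f a = k * 'D_v f a.
Proof. by move=> /derivableP /(is_derive_dirZ k) [_ <-]. Qed.

Lemma small01 (t h d : R) : 0 <= t <= 1 -> `|h| < d -> `|t * h| < d.
Proof.
move=> /andP[t0 t1]; apply: le_lt_trans.
by rewrite normrM (ger0_norm t0) ler_piMl.
Qed.

(** Go from a to a + h (u + v) through a + h u; on the second leg the mean value
    theorem gives the derivative along v at a nearby point, and continuity applies. *)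
Lemma derive_dirD f a u v : C1 f -> P a -> Symm R n u -> Symm R n v ->
  'D_(u + v) f a = 'D_u f a + 'D_v f a.
Proof.
move=> Cf Pa su sv; apply: cvg_lim => //; apply/cvgrPdist_lt => e e0.
have e20 : 0 < e / 2 by rewrite divr_gt0.
have [dv cv] := Cf v sv; have [du _] := Cf u su.
have [d1 d10 h1] := near_plane u v (posdef_open Pa).
have [d2 d20 h2] := near_plane u v (cv a Pa _ e20).
have PP s t : `|s| < d1 -> `|t| < d1 -> P (s *: u + t *: v + a).
  by move=> sd td; apply: h1 => //; apply: SymmD; [apply: SymmD; exact: SymmZ | case: Pa].
have := du a Pa; rewrite /derivable => /cvgrPdist_lt /(_ _ e20) hu.
near=> h.
have hd1 : `|h| < d1 by near: h; exact: dnbhs0_lt.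
have hd2 : `|h| < d2 by near: h; exact: dnbhs0_lt.
have hn0 : h != 0 by near: h; exact: nbhs_dnbhs_neq.
pose b := h *: u + a; pose b' := h *: (u + v) + a.
have bb : b' - b = h *: v by rewrite /b' /b scalerDr opprD addrACA subrr addr0 addrAC subrr add0r.
have Pb : P b by have := PP h 0; rewrite scale0r addr0; apply; rewrite ?normr0.
have Pb' : P b' by rewrite /b' scalerDr; exact: PP.
have [|t t01] := @mvt_segment f b b' Pb Pb'.
  by move=> x Px; rewrite bb; have [] := is_derive_dirZ h (derivableP (dv x Px)).
rewrite bb => e1.
have xE : t *: (h *: v) + b = h *: u + (t * h) *: v + a.
  by rewrite scalerA /b addrA [_ *: v + _]addrC.
have Px : P (t *: (h *: v) + b) by rewrite xE; apply: PP => //; exact: small01.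
rewrite derivable_dirZ in e1; last exact: dv.
have hx : `|'D_v f a - 'D_v f (t *: (h *: v) + b)| < e / 2.
  by move: (Px); rewrite xE; apply: h2 => //; exact: small01.
have hq : `|'D_u f a - h^-1 *: (f (h *: u + a) - f a)| < e / 2.
  by near: h; exact: hu.
rewrite -/b' -/b in hq *.
have -> : h^-1 *: (f b' - f a) = h^-1 *: (f b - f a) + 'D_v f (t *: (h *: v) + b).
  have -> : f b' - f a = (f b - f a) + (f b' - f b) by ring.
  by rewrite scalerDr e1 [h^-1 *: (h * _)]mulKf.
rewrite opprD addrACA.
by apply: le_lt_trans (ler_normD _ _) _; rewrite (splitr e) ltrD.
Unshelve. all: by end_near. Qed.

(** The second difference of f over a parallelogram with sides h u and h v does not
    depend on the order of u and v. Two applications of the mean value theorem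
    write it as h^2 times either mixed derivative at a nearby point. *)
Lemma schwarz f a u v : P a -> Symm R n u -> Symm R n v ->
  (forall x, P x -> derivable f x u) -> (forall x, P x -> derivable f x v) ->
  (forall x, P x -> derivable (fun x => 'D_u f x) x v) ->
  (forall x, P x -> derivable (fun x => 'D_v f x) x u) ->
  cont_posdef (fun x => 'D_v (fun x => 'D_u f x) x) ->
  cont_posdef (fun x => 'D_u (fun x => 'D_v f x) x) ->
  'D_v (fun x => 'D_u f x) a = 'D_u (fun x => 'D_v f x) a.
Proof.
move=> Pa su sv.
have half u' v' : Symm R n u' -> Symm R n v' ->
  (forall x, P x -> derivable f x u') ->
  (forall x, P x -> derivable (fun x => 'D_u' f x) x v') ->
  cont_posdef (fun x => 'D_v' (fun x => 'D_u' f x) x) ->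
  forall e : R, 0 < e -> exists2 d : R, 0 < d & forall h : R, 0 < h < d ->
    `|'D_v' (fun x => 'D_u' f x) a -
      (f (h *: u' + h *: v' + a) - f (h *: u' + a) - f (h *: v' + a) + f a) / h ^+ 2| < e.
  move=> {su sv} su sv du dvu c e e0.
  have [d1 d10 h1] := near_plane u' v' (posdef_open Pa).
  have [d2 d20 h2] := near_plane u' v' (c a Pa _ e0).
  have PP s t : `|s| < d1 -> `|t| < d1 -> P (s *: u' + t *: v' + a).
    by move=> sd td; apply: h1 => //; apply: SymmD; [apply: SymmD; exact: SymmZ | case: Pa].
  exists (Num.min d1 d2); first by rewrite lt_min d10 d20.
  move=> h /andP[h0]; rewrite lt_min => /andP[hd1 hd2].
  have nh : `|h| = h by rewrite gtr0_norm.
  pose phi (s : R) := f (s *: (h *: u') + (h *: v' + a)) - f (s *: (h *: u') + a).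
  have P1 s : 0 <= s <= 1 -> P (s *: (h *: u') + (h *: v' + a)).
    by move=> s01; rewrite scalerA addrA; apply: PP; rewrite ?nh //; apply: small01; rewrite ?nh.
  have P2 s : 0 <= s <= 1 -> P (s *: (h *: u') + a).
    move=> s01; have := PP (s * h) 0; rewrite scale0r addr0 scalerA; apply; rewrite ?normr0 //.
    by apply: small01; rewrite ?nh.
  have [s s01 e1] := @mvt_unit phi (fun s => h * 'D_u' f (s *: (h *: u') + (h *: v' + a))
      - h * 'D_u' f (s *: (h *: u') + a)) (fun s s01 => is_deriveB
       (is_derive_lineP_at (is_derive_dirZ h (derivableP (du _ (P1 _ s01)))))
       (is_derive_lineP_at (is_derive_dirZ h (derivableP (du _ (P2 _ s01)))))).
  pose b := s *: (h *: u') + a; pose b' := s *: (h *: u') + (h *: v' + a).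
  have bb : b' - b = h *: v' by rewrite /b' /b opprD addrACA subrr add0r addrK.
  have [|t t01] := @mvt_segment (fun x => 'D_u' f x) b b' (P2 s s01) (P1 s s01).
    by move=> x Px; rewrite bb; have [] := is_derive_dirZ h (derivableP (dvu x Px)).
  rewrite bb => e2.
  have xE : t *: (h *: v') + b = (s * h) *: u' + (t * h) *: v' + a.
    by rewrite !scalerA /b scalerA addrA [_ *: v' + _]addrC.
  have Px : P (t *: (h *: v') + b) by rewrite xE; apply: PP; apply: small01; rewrite ?nh.
  rewrite derivable_dirZ in e2; last exact: dvu.
  have -> : (f (h *: u' + h *: v' + a) - f (h *: u' + a) - f (h *: v' + a) + f a) / h ^+ 2
     = 'D_v' (fun x => 'D_u' f x) (t *: (h *: v') + b).
    have -> : f (h *: u' + h *: v' + a) - f (h *: u' + a) - f (h *: v' + a) + f a = phi 1 - phi 0.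
      by rewrite /phi !scale1r !scale0r !add0r addrA; ring.
    by rewrite e1 -mulrBr -/b -/b' e2; field; rewrite gt_eqF.
  by move: (Px); rewrite xE; apply: h2; apply: small01; rewrite ?nh.
move=> du dv dvu duv c1 c2; apply/eqP; rewrite -subr_eq0 -normr_le0; apply/ler_addgt0Pr => e e0.
rewrite add0r; have e20 : 0 < e / 2 by rewrite divr_gt0.
have [d1 d10 h1] := half u v su sv du dvu c1 _ e20.
have [d2 d20 h2] := half v u sv su dv duv c2 _ e20.
pose h := Num.min d1 d2 / 2.
have m0 : 0 < Num.min d1 d2 by rewrite lt_min d10 d20.
have hm : h < Num.min d1 d2 by rewrite /h ltr_pdivrMr // mulr_natr mulr2n ltrDl.
have h0 : 0 < h by rewrite divr_gt0.
move: (hm); rewrite lt_min => /andP[hd1 hd2].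
have := h1 h; rewrite h0 hd1 => /(_ isT); have := h2 h; rewrite h0 hd2 => /(_ isT).
have -> : f (h *: v + h *: u + a) - f (h *: v + a) - f (h *: u + a) + f a =
    f (h *: u + h *: v + a) - f (h *: u + a) - f (h *: v + a) + f a.
  by rewrite [h *: v + h *: u]addrC; congr (_ + _); exact: addrAC.
set q2 := _ / h ^+ 2.
move=> k2 k1; rewrite (splitr e).
have -> : 'D_v (fun x => 'D_u f x) a - 'D_u (fun x => 'D_v f x) a =
    ('D_v (fun x => 'D_u f x) a - q2) - ('D_u (fun x => 'D_v f x) a - q2).
  by rewrite opprB addrA subrK.
exact: le_trans (ler_normB _ _) (ltW (ltrD k1 k2)).
Qed.

Lemma derive_dir_sum f a (I : finType) (F : I -> 'M[R]_n) : C1 f -> P a ->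
  (forall i, Symm R n (F i)) -> 'D_(\sum_i F i) f a = \sum_i 'D_(F i) f a.
Proof.
move=> Cf Pa sF.
suff [] : Symm R n (\sum_i F i) /\ 'D_(\sum_i F i) f a = \sum_i 'D_(F i) f a by [].
elim: (index_enum I) => [|i s [IH1 IH2]]; first by rewrite !big_nil derive0; split=> //; exact: Symm0.
by rewrite !big_cons derive_dirD // IH2; split=> //; exact: SymmD.
Qed.

(** Derivatives in moving directions are reduced to fixed directions, for which
    continuity is known. *)
Lemma derive_dirE f a v : C1 f -> P a -> Symm R n v ->
  'D_v f a = \sum_i \sum_j v i j * 'D_(symdelta R i j) f a.
Proof.
move=> Cf Pa sv; rewrite {1}(sym_decomp sv) derive_dir_sum //; last first.
  move=> i; apply/SymmE; rewrite raddf_sum; apply: eq_bigr => j _.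
  exact: ((SymmE _).1 (SymmZ (v i j) (symdelta_sym R i j))).
apply: eq_bigr => i _; rewrite derive_dir_sum //; last by move=> j; exact/SymmZ/symdelta_sym.
apply: eq_bigr => j _; rewrite derivable_dirZ //.
by have [d _] := Cf _ (symdelta_sym R i j); exact: d.
Qed.

Lemma cvg_sumf (T : Type) (F : set_system T) (FF : Filter F) (I : finType)
  (f : I -> T -> R) (l : I -> R) : (forall i, f i @ F --> l i) ->
  (fun y => \sum_i f i y) @ F --> \sum_i l i.
Proof.
move=> h; elim: (index_enum I) => [|i s IH].
  by under eq_fun do rewrite big_nil; rewrite big_nil; exact: cvg_cst.
by under eq_fun do rewrite big_cons; rewrite big_cons; exact: (cvgD (h i) IH).
Qed.

(** The mean value theorem on the segment from c t to c (h + t) writes the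
    difference quotient as the derivative of f at a nearby point in the direction of
    the difference quotient of c. Expand this direction with derive_dirE and pass to
    the limit. *)
Lemma chain_rule f (c : R -> 'M[R]_n) (t : R) v : C1 f ->
  (\forall s \near t, P (c s)) -> is_derive t 1 c v -> Symm R n v ->
  is_derive t 1 (fun s => f (c s)) ('D_v f (c t)).
Proof.
move=> Cf near_c hc sv; set a := c t.
have Pa : P a by exact: nbhs_singleton near_c.
(* th h is the position of the intermediate point on the segment. *)
have /choice [th hth] : forall h : R, exists s : R, 0 <= s <= 1 /\
    (P (c (h + t)) -> f (c (h + t)) - f a = 'D_(c (h + t) - a) f (s *: (c (h + t) - a) + a)).
  move=> h; have [Pc|nP] := pselect (P (c (h + t))); last first.
    by exists 0; rewrite lexx ler01.
  have sb : Symm R n (c (h + t) - a) by apply: SymmB; [case: Pc | case: Pa].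
  have [d _] := Cf _ sb.
  by have [s s01 e] := mvt_segment Pa Pc d; exists s.
pose x h := th h *: (c (h + t) - a) + a.
pose w h := h^-1 *: (c (h + t) - a).
have near_c0 : \forall h \near (0 : R)^', P (c (h + t)).
  have : \forall h \near (0 : R), P (c (h + t)).
    by have := near_c; rewrite (near_shift 0 t) /=; apply: filterS => h; rewrite /= subr0.
  by apply: cvg_within.
have wv : w @ (0 : R)^' --> v.
  have [dc <-] := hc; move: dc; rewrite /derivable /derive /=.
  by under eq_fun do rewrite [_%:A]mulr1.
have ca : (fun h => c (h + t)) @ (0 : R)^' --> a.
  have : (fun h => c (h + t)) @ (0 : R) --> a.
    have cc : (fun h : R => c (h *: 1 + t)) @ (0 : R) --> c (0 *: 1 + t).
      exact: is_derive1_continuous ((is_derive_lineP c t 1 v).1 hc).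
    have e1 : 0 *: 1 + t = t by rewrite scale0r add0r.
    have e2 : (fun h : R => c (h *: 1 + t)) = (fun h => c (h + t)).
      by apply/funext => h; rewrite [_%:A]mulr1.
    by rewrite e1 e2 in cc.
  by apply: cvg_within_filter.
have xa : x @ (0 : R)^' --> a.
  apply/cvgrPdist_lt => e e0; apply: filterS ((cvgrPdist_lt _ _).1 ca e e0) => h.
  apply: le_lt_trans; rewrite /x opprD addrCA subrr addr0 normrN normrZ distrC.
  have [/andP[th0 th1] _] := hth h.
  by rewrite (ger0_norm th0) ler_piMl.
have Px : \forall h \near (0 : R)^', P (x h).
  apply: filterS near_c0 => h Pc; apply: posdef_convex => //.
  by have [] := hth h.
have Dx i j : (fun h => 'D_(symdelta R i j) f (x h)) @ (0 : R)^' --> 'D_(symdelta R i j) f a.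
  apply/cvgrPdist_lt => e e0; have [_ cd] := Cf _ (symdelta_sym R i j).
  have h1 : \forall h \near (0 : R)^', P (x h) ->
    `|'D_(symdelta R i j) f a - 'D_(symdelta R i j) f (x h)| < e := xa _ (cd a Pa e e0).
  by apply: filterS2 Px h1 => h h2; exact.
have wij i j : (fun h => w h i j) @ (0 : R)^' --> v i j.
  exact: (cvg_comp _ _ wv (@coord_continuous R n n i j v)).
have lim : (fun h => \sum_i \sum_j w h i j * 'D_(symdelta R i j) f (x h)) @ (0 : R)^' -->
    'D_v f a.
  rewrite (derive_dirE Cf Pa sv); apply: cvg_sumf => i; apply: cvg_sumf => j.
  exact: cvgM (wij i j) (Dx i j).
have q : (fun h => h^-1 *: (f (c (h *: 1 + t)) - f (c t))) @ (0 : R)^' --> 'D_v f a.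
  apply: cvg_trans lim; apply: near_eq_cvg.
  have hn0 : \forall h \near (0 : R)^', h != 0 by exact: nbhs_dnbhs_neq.
  apply: filterS3 hn0 near_c0 Px => h h0 Pc Pxh; rewrite [h *: 1]mulr1.
  have sw : Symm R n (w h) by apply/SymmZ/SymmB; [case: Pc | case: Pa].
  rewrite -(derive_dirE Cf Pxh sw) /w; have [_ /(_ Pc) ->] := hth h.
  rewrite derivable_dirZ //; have [d _] := Cf _ (SymmB (proj1 Pc) (proj1 Pa)).
  exact: d.
by split; [apply/cvg_ex; exists ('D_v f a); exact: q | exact: cvg_lim q].
Qed.

End ContinuouslyDifferentiable.

(** * The trace metric along curves *)

Section TraceForms.
Variables (R : realType) (n : nat).
Implicit Types (A X Y Z V W : 'M[R]_n).

(** The cubic form that appears in the derivative of the trace metric. It is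
    totally symmetric on symmetric matrices. *)
Definition cubic_trace A X Y Z : R :=
  \tr (invmx A *m X *m invmx A *m Y *m invmx A *m Z).

Lemma trace_metricC A X Y : trace_metric A X Y = trace_metric A Y X.
Proof.
have E Z W : trace_metric A Z W = \tr ((invmx A *m Z) *m (invmx A *m W)).
  by rewrite /trace_metric !mulmxA.
by rewrite !E mxtrace_mulC.
Qed.

Lemma trace_metricDl A X X' Y :
  trace_metric A (X + X') Y = trace_metric A X Y + trace_metric A X' Y.
Proof. by rewrite /trace_metric mulmxDr !mulmxDl mxtraceD. Qed.

Lemma trace_metricBl A X X' Y :
  trace_metric A (X - X') Y = trace_metric A X Y - trace_metric A X' Y.
Proof. by rewrite /trace_metric mulmxBr !mulmxBl raddfB. Qed.

Lemma cubic_trace_rot A X Y Z : cubic_trace A X Y Z = cubic_trace A Y Z X.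
Proof.
have -> : cubic_trace A X Y Z = \tr ((invmx A *m X) *m (invmx A *m Y *m invmx A *m Z)).
  by rewrite /cubic_trace !mulmxA.
by rewrite mxtrace_mulC !mulmxA.
Qed.

(** Transposition reverses the order of the factors. *)
Lemma cubic_trace_swap A X Y Z : A^T = A -> Symm R n X -> Symm R n Y -> Symm R n Z ->
  cubic_trace A X Y Z = cubic_trace A X Z Y.
Proof.
move=> sA /SymmE sX /SymmE sY /SymmE sZ.
rewrite [RHS](_ : _ = cubic_trace A Y X Z); last by rewrite [RHS]cubic_trace_rot.
rewrite {1}/cubic_trace -mxtrace_tr !trmx_mul trmx_inv sA sX sY sZ.
by rewrite mxtrace_mulC /cubic_trace !mulmxA.
Qed.

Lemma is_derive_Symm (c : R -> 'M[R]_n) (t : R) D :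
  (\forall s \near t, Symm R n (c s)) -> is_derive t 1 c D -> Symm R n D.
Proof.
move=> sc /is_derive_mxP hc; apply/SymmE/matrixP => i j; rewrite mxE.
apply: (is_derive_unique (hc j i)); apply: near_eq_is_derive (hc i j).
by apply: filterS sc => s /SymmE {1}<-; rewrite mxE.
Qed.

(** The two terms from the derivatives of the inverse of c agree by
    the symmetry of cubic_trace. *)
Lemma is_derive_trace_metric (c f g : R -> 'M[R]_n) (t : R) c' f' g' :
  posdefmx R n (c t) -> Symm R n (f t) -> Symm R n (g t) -> Symm R n c' ->
  is_derive t 1 c c' -> is_derive t 1 f f' -> is_derive t 1 g g' ->
  is_derive t 1 (fun s => trace_metric (c s) (f s) (g s))
    (trace_metric (c t) f' (g t) + trace_metric (c t) (f t) g'
     - 2 * cubic_trace (c t) c' (f t) (g t)).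
Proof.
move=> Pc sf sg sc' hc hf hg.
have hi := is_derive_invmx (posdef_unit Pc) hc.
have h := is_derive_mxtrace (is_derive_mulmx (is_derive_mulmx (is_derive_mulmx hi hf) hi) hg).
apply: is_derive_eq h _.
rewrite !(mulmxDl, mxtraceD) !(mulmxN, mulNmx) !raddfN /=.
have e1 : \tr (invmx (c t) *m f t *m (invmx (c t) *m c' *m invmx (c t)) *m g t) =
    cubic_trace (c t) c' (f t) (g t).
  by rewrite cubic_trace_rot -cubic_trace_swap ?(posdef_sym Pc) // /cubic_trace !mulmxA.
have e2 : \tr (invmx (c t) *m c' *m invmx (c t) *m f t *m invmx (c t) *m g t) =
    cubic_trace (c t) c' (f t) (g t) by [].
by rewrite e1 e2 /trace_metric; ring.
Qed.

End TraceForms.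

(** * First and second derivatives of an isometry *)

Section IsometryDerivatives.
Variables (R : realType) (n : nat).
Implicit Types (A B M V W U X : 'M[R]_n) (f : 'M[R]_n -> 'M[R]_n).

Local Notation P := (posdefmx R n).
Local Notation S := (Symm R n).

Lemma cont_posdef_entry (g : 'M[R]_n -> 'M[R]_n) i j :
  {within P, continuous g} -> cont_posdef (fun A => g A i j).
Proof.
move=> /subspace_continuousP cg a Pa e e0.
have h : (fun A => g A i j) @ within P (nbhs a) --> g a i j.
  exact: (cvg_comp _ _ (cg a Pa) (@coord_continuous R n n i j (g a))).
exact: ((cvgrPdist_lt _ _).1 h e e0).
Qed.

Lemma cont_posdef_ext (f g : 'M[R]_n -> R) : (forall A, P A -> f A = g A) -> cont_posdef f -> cont_posdef g.
Proof.
move=> fg cf a Pa e e0; apply: filterS (cf a Pa e e0) => x h Px.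
by rewrite -!fg //; exact: h.
Qed.

Definition C1mx (f : 'M[R]_n -> 'M[R]_n) := forall V, S V ->
  (forall A, P A -> derivable f A V) /\ {within P, continuous (fun A => 'D_V f A)}.

Lemma C1mx_entry f i j : C1mx f -> C1 (fun A => f A i j).
Proof.
move=> Cf V sV; have [df cf] := Cf V sV; split=> [A PA|].
  by have /derivable_mxP := df A PA; apply.
apply: cont_posdef_ext (cont_posdef_entry i j cf) => A PA.
by rewrite (derive_mx (df A PA)) mxE.
Qed.

Lemma derive_entry f A V i j : derivable f A V ->
  'D_V (fun A => f A i j) A = ('D_V f A : 'M[R]_n) i j.
Proof. by move=> df; rewrite (derive_mx df) mxE. Qed.

Lemma chain_rule_mx f (c : R -> 'M[R]_n) (t : R) V : C1mx f ->
  (\forall s \near t, P (c s)) -> is_derive t 1 c V -> S V ->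
  is_derive t 1 (fun s => f (c s)) ('D_V f (c t)).
Proof.
move=> Cf near_c hc sV; have [df _] := Cf V sV.
have Pc : P (c t) by exact: nbhs_singleton near_c.
apply/is_derive_mxP => i j; rewrite -(derive_entry i j (df _ Pc)).
exact: chain_rule (C1mx_entry i j Cf) near_c hc sV.
Qed.

Lemma derive_dirE_mx f A V : C1mx f -> P A -> S V ->
  'D_V f A = \sum_i \sum_j V i j *: 'D_(symdelta R i j) f A.
Proof.
move=> Cf PA sV; apply/matrixP => k l; have [df _] := Cf V sV.
rewrite -(derive_entry k l (df _ PA)) (derive_dirE (C1mx_entry k l Cf) PA sV).
rewrite summxE; apply: eq_bigr => i _; rewrite summxE; apply: eq_bigr => j _.
rewrite mxE -(derive_entry k l) //.
by have [d _] := Cf _ (symdelta_sym R i j); exact: d.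
Qed.

Lemma derive_dirD_mx f A V W : C1mx f -> P A -> S V -> S W ->
  'D_(V + W) f A = 'D_V f A + 'D_W f A.
Proof.
move=> Cf PA sV sW; have [dV _] := Cf V sV; have [dW _] := Cf W sW.
have [dVW _] := Cf _ (SymmD sV sW).
apply/matrixP => k l; rewrite [RHS]mxE.
apply: etrans (esym (derive_entry k l (dVW _ PA))) _.
apply: etrans (derive_dirD (C1mx_entry k l Cf) PA sV sW) _.
by congr (_ + _); [exact: derive_entry k l (dV _ PA) | exact: derive_entry k l (dW _ PA)].
Qed.

Lemma derive_dirZ_mx f A V (k : R) : C1mx f -> P A -> S V ->
  'D_(k *: V) f A = k *: 'D_V f A.
Proof.
move=> Cf PA sV; have [dV _] := Cf V sV; have [dkV _] := Cf _ (SymmZ k sV).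
apply/matrixP => i j; rewrite [RHS]mxE.
apply: etrans (esym (derive_entry i j (dkV _ PA))) _.
have [d _] := C1mx_entry i j Cf sV; apply: etrans (derivable_dirZ k (d A PA)) _.
by congr (_ * _); exact: derive_entry i j (dV _ PA).
Qed.

Variable L : 'M[R]_n -> 'M[R]_n.
Hypothesis isoL : trace_isometry L.

Local Notation F := (fun V A => 'D_V L A).

Lemma iso_fun A : P A -> P (L A).
Proof. by case: isoL => -[LP _ _] _; exact: LP. Qed.

Lemma iso_C1 : C1mx L.
Proof.
case: isoL => -[_ sm _] _ V sV; have [_ /(_ V sV) [d [c _]]] := sm 1%N; split => //.
Qed.

Lemma iso_C2 V : S V -> C1mx (F V).
Proof.
move=> sV; case: isoL => -[_ sm _] _ W sW.
have [_ /(_ V sV) [_ [_ /(_ W sW) [d [c _]]]]] := sm 2%N; split => //.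
Qed.

Lemma iso_derivable A V : P A -> S V -> derivable L A V.
Proof. by move=> PA sV; have [d _] := iso_C1 sV; exact: d. Qed.

Lemma iso_metric A V W : P A -> S V -> S W ->
  trace_metric (L A) (F V A) (F W A) = trace_metric A V W.
Proof. by case: isoL => _; apply. Qed.

Lemma iso_line A V : P A -> S V -> is_derive (0 : R) 1 (fun h : R => L (h *: V + A)) (F V A).
Proof.
by move=> PA sV; exact: (is_derive_lineP L A V _).1 (derivableP (iso_derivable PA sV)).
Qed.

Lemma iso_derive_Symm A V : P A -> S V -> S (F V A).
Proof.
move=> PA sV; apply: (is_derive_Symm _ (iso_line PA sV)).
by apply: filterS (posdef_line PA sV) => h /iso_fun [].
Qed.

Lemma iso_line2 A V U : P A -> S V -> S U ->
  is_derive (0 : R) 1 (fun h : R => F V (h *: U + A)) ('D_U (F V) A).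
Proof.
move=> PA sV sU; have [d _] := iso_C2 sV sU.
exact: (is_derive_lineP (F V) A U _).1 (derivableP (d A PA)).
Qed.

Lemma iso_derive2_Symm A V U : P A -> S V -> S U -> S ('D_U (F V) A).
Proof.
move=> PA sV sU; apply: (is_derive_Symm _ (iso_line2 PA sV sU)).
by apply: filterS (posdef_line PA sU) => h Ph; exact: iso_derive_Symm.
Qed.

Lemma iso_schwarz A V U : P A -> S V -> S U -> 'D_U (F V) A = 'D_V (F U) A.
Proof.
move=> PA sV sU.
have dF V' U' B : S V' -> S U' -> P B -> derivable (F V') B U'.
  by move=> sV' sU' PB; have [d _] := iso_C2 sV' sU'; exact: d.
have eF V' i j B : S V' -> P B -> 'D_V' (fun A => L A i j) B = (F V' B : 'M[R]_n) i j.
  by move=> sV' PB; apply: derive_entry; exact: iso_derivable.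
have e2 V' U' i j B : S V' -> S U' -> P B ->
   is_derive B U' (fun A => 'D_V' (fun A => L A i j) A) (('D_U' (F V') B : 'M[R]_n) i j).
  move=> sV' sU' PB; apply: (is_derive_lineP _ B U' _).2.
  have /is_derive_mxP /(_ i j) h := iso_line2 PB sV' sU'.
  by apply: near_eq_is_derive h; apply: filterS (posdef_line PB sU') => h Ph; rewrite eF.
apply/matrixP => i j.
have d1 := @derive_val _ _ _ _ _ _ _ (e2 V U i j A sV sU PA).
have d2 := @derive_val _ _ _ _ _ _ _ (e2 U V i j A sU sV PA).
have cc V' U' : S V' -> S U' -> cont_posdef (fun B => 'D_U' (fun A => 'D_V' (fun A => L A i j) A) B).
  move=> sV' sU'; have [_ c2] := iso_C2 sV' sU'.
  apply: cont_posdef_ext (cont_posdef_entry i j c2) => B PB.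
  exact: esym (@derive_val _ _ _ _ _ _ _ (e2 V' U' i j B sV' sU' PB)).
apply: etrans (esym d1) (etrans _ d2).
apply: (schwarz PA sV sU _ _ _ _ (cc V U sV sU) (cc U V sU sV)).
- by move=> B PB; have /derivable_mxP := iso_derivable PB sV; apply.
- by move=> B PB; have /derivable_mxP := iso_derivable PB sU; apply.
- by move=> B PB; have [] := e2 V U i j B sV sU PB.
- by move=> B PB; have [] := e2 U V i j B sU sV PB.
Qed.

(** Differentiate the isometry relation at A in the direction U. *)
Lemma iso_koszul A U V W : P A -> S U -> S V -> S W ->
  trace_metric (L A) ('D_U (F V) A) (F W A) + trace_metric (L A) (F V A) ('D_U (F W) A)
  = 2 * (cubic_trace (L A) (F U A) (F V A) (F W A) - cubic_trace A U V W).
Proof.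
move=> PA sU sV sW.
have z0 : 0 *: U + A = A by rewrite scale0r add0r.
have h1 := is_derive_trace_metric (c := fun h : R => L (h *: U + A)) (t := 0)
  (f := fun h => F V (h *: U + A)) (g := fun h => F W (h *: U + A)).
rewrite z0 in h1.
have {}h1 := h1 _ _ _ (iso_fun PA) (iso_derive_Symm PA sV) (iso_derive_Symm PA sW)
  (iso_derive_Symm PA sU) (iso_line PA sU) (iso_line2 PA sV sU) (iso_line2 PA sW sU).
have h2 := is_derive_trace_metric (c := fun h : R => h *: U + A) (t := 0)
  (f := fun h => V) (g := fun h => W).
rewrite z0 in h2.
have hl : is_derive (0 : R) 1 (fun h : R => h *: U + A) U.
  exact: (is_derive_lineP (fun B => B) A U U).1.
have {}h2 := h2 _ _ _ PA sV sW sU hl (is_derive_cst V (0 : R) (1 : R)) (is_derive_cst W (0 : R) (1 : R)).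
have near_m : \forall h \near (0 : R), trace_metric (L (h *: U + A)) (F V (h *: U + A))
   (F W (h *: U + A)) = trace_metric (h *: U + A) V W.
  by apply: filterS (posdef_line PA sU) => h Ph; exact: iso_metric.
have arith (x y t s : R) : x + y - 2 * t = 0 + 0 - 2 * s -> x + y = 2 * (t - s) by lra.
apply: arith; apply: etrans (is_derive_unique (near_eq_is_derive near_m h1) h2) _.
by congr (_ + _ - _); rewrite /trace_metric ?mulmx0 ?mul0mx ?mxtrace0.
Qed.

(** The argument of Koszul's formula: the second derivative is symmetric in its
    two directions, iso_koszul gives the part that is symmetric in the two last slots,
    and together they determine it. Geometrically, L preserves the Levi-Civita
    connection. *)
Lemma iso_hessian A V W : P A -> S V -> S W ->
  trace_metric (L A) ('D_V (F V) A) (F W A) =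
  cubic_trace (L A) (F V A) (F V A) (F W A) - cubic_trace A V V W.
Proof.
move=> PA sV sW.
have arith (m k m' k' a b a' b' : R) : m + k = 2 * (a - b) -> m' + k' = 2 * (a' - b') ->
  k = m' -> k' = m' -> a' = a -> b' = b -> m = a - b by lra.
have gen (X Y Z : 'M[R]_n) : X = Y -> trace_metric (L A) Z X = trace_metric (L A) Y Z.
  by move=> ->; exact: trace_metricC.
apply: (arith _ _ _ _ _ _ _ _ (iso_koszul PA sV sV sW) (iso_koszul PA sW sV sV)).
- exact: gen (iso_schwarz PA sW sV).
- exact: trace_metricC.
- exact: cubic_trace_rot.
- exact: cubic_trace_rot.
Qed.

End IsometryDerivatives.

(** * Geodesics *)

Section Geodesics.
Variables (R : realType) (n : nat).
Implicit Types (A B M V W U X Q : 'M[R]_n) (d : 'rV[R]_n) (c : R -> 'M[R]_n) (t : R).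

Local Notation P := (posdefmx R n).
Local Notation S := (Symm R n).

(** A curve together with its velocity. The geodesic equation of the trace metric
    is c'' = c' c^-1 c'. *)
Record geodesic c c1 : Prop := Geodesic {
  geo_pos : forall t, P (c t);
  geo_vel : forall t, is_derive t 1 c (c1 t);
  geo_acc : forall t, is_derive t 1 c1 (c1 t *m invmx (c t) *m c1 t) }.

Lemma near_everywhere (Q : R -> Prop) t : (forall s, Q s) -> \forall s \near t, Q s.
Proof. by move=> h; near=> s; exact: h. Unshelve. all: by end_near. Qed.

Lemma geo_symm c c1 : geodesic c c1 -> forall t, S (c1 t).
Proof.
move=> gc t; apply: (is_derive_Symm _ (geo_vel gc t)).
by apply: near_everywhere => s; case: (geo_pos gc s).
Qed.

Lemma geo_inv c c1 : geodesic c c1 ->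
  forall t, is_derive t 1 (fun s => invmx (c s)) (- (invmx (c t) *m c1 t *m invmx (c t))).
Proof.
by move=> gc t; apply: is_derive_invmx (geo_vel gc t); exact/posdef_unit/(geo_pos gc).
Qed.

(** The geodesic equation says that c^-1 c' is constant. *)
Lemma geo_left c c1 : geodesic c c1 -> forall t, c1 t = c t *m (invmx (c 0) *m c1 0).
Proof.
move=> gc t; have u s := posdef_unit (geo_pos gc s).
have h : forall s t, invmx (c s) *m c1 s = invmx (c t) *m c1 t.
  apply: (is_derive0_cst (c := fun s => invmx (c s) *m c1 s)) => s.
  apply: is_derive_eq (is_derive_mulmx (geo_inv gc s) (geo_acc gc s)) _.
  by rewrite mulNmx !mulmxA addNr.
by rewrite (h 0 t) mulKVmx.
Qed.

(** Likewise, c' c^-1 is constant. *)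
Lemma geo_right c c1 : geodesic c c1 -> forall t, c1 t = (c1 0 *m invmx (c 0)) *m c t.
Proof.
move=> gc t; have u s := posdef_unit (geo_pos gc s).
have h : forall s t, c1 s *m invmx (c s) = c1 t *m invmx (c t).
  apply: (is_derive0_cst (c := fun s => c1 s *m invmx (c s))) => s.
  apply: is_derive_eq (is_derive_mulmx (geo_acc gc s) (geo_inv gc s)) _.
  by rewrite mulmxN !mulmxA subrr.
by rewrite (h 0 t) mulmxKV.
Qed.

Lemma is_derive_opp_arg c t V :
  is_derive (- t) 1 c V -> is_derive t 1 (fun s => c (- s)) (- V).
Proof.
move=> /is_derive_mxP h; apply/is_derive_mxP => i j; rewrite mxE.
have ho : is_derive t 1 (fun s : R => - s) (-1).
  exact: is_deriveNid.
have := @is_derive1_comp R (fun s => c s i j) (fun s : R => - s) t _ _ (h i j) ho.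
by rewrite mulrN1.
Qed.

(** By geo_left and geo_right the left-hand side has zero derivative. The map
    B |-> A B^-1 A is thus the geodesic symmetry at A. *)
Lemma geo_reflect c c1 : geodesic c c1 ->
  forall t, c (- t) *m invmx (c 0) *m c t = c 0.
Proof.
move=> gc t; have u s := posdef_unit (geo_pos gc s).
have h : forall s t, c (- s) *m invmx (c 0) *m c s = c (- t) *m invmx (c 0) *m c t.
  apply: (is_derive0_cst (c := fun s => c (- s) *m invmx (c 0) *m c s)) => s.
  have h1 := is_derive_rmulmx (invmx (c 0)) (is_derive_opp_arg (geo_vel gc (- s))).
  apply: is_derive_eq (is_derive_mulmx h1 (geo_vel gc s)) _.
  by rewrite (geo_left gc (- s)) (geo_right gc s) !mulNmx !mulmxA addNr.
by rewrite (h t 0) oppr0 mulmxV // mul1mx.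
Qed.

Lemma is_derive_spectral_exp Q d t : Q *m Q^T = 1%:M ->
  is_derive t 1 (fun s => spectral_exp Q (s *: d)) (spectral_exp Q (t *: d) *m (Q *m diag_mx d *m Q^T)).
Proof.
move=> QQ; rewrite /spectral_exp ortho_conjM //.
apply: is_derive_rmulmx; apply: is_derive_lmulmx.
apply/is_derive_mxP => i j; rewrite mul_mx_diag !mxE.
have -> : (fun s : R => diag_mx (map_mx expR (s *: d)) i j) =
    (fun s : R => (i == j)%:R * expR (s * d 0 i)).
  by apply/funext => s; rewrite !mxE mulr_natl.
have hl : is_derive t 1 (fun s : R => s * d 0 i) (d 0 i).
  apply: is_derive_eq (is_derive_mulf (is_derive_id _ _) (is_derive_cst (d 0 i) t 1)) _.
  by rewrite mulr0 addr0 mul1r.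
have he : is_derive t 1 (fun s : R => expR (s * d 0 i)) (expR (t * d 0 i) * d 0 i).
  exact: (@is_derive1_comp R expR (fun s => s * d 0 i) t _ _ (is_derive_expR _) hl).
have hc : is_derive t 1 (fun _ : R => (i == j)%:R : R) 0 by exact: is_derive_cst.
apply: is_derive_eq (is_derive_mulf hc he) _.
rewrite mul0r add0r mulrA mulr_natl; case: eqVneq => [->//|_].
by rewrite mulr0n !mul0r.
Qed.

Lemma spectral_exp_commute Q d e : Q *m Q^T = 1%:M ->
  (Q *m diag_mx e *m Q^T) *m spectral_exp Q d = spectral_exp Q d *m (Q *m diag_mx e *m Q^T).
Proof.
move=> QQ; rewrite /spectral_exp !ortho_conjM // !mulmx_diag; congr (_ *m diag_mx _ *m _).
by apply/rowP => i; rewrite !mxE mulrC.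
Qed.

Lemma congr_inv M A B : M \in unitmx -> A *m B = 1%:M ->
  invmx (M *m A *m M^T) = invmx M^T *m B *m invmx M.
Proof.
move=> uM AB; apply: mulmx1_inv.
by rewrite !mulmxA mulmxK ?unitmx_tr // -[M *m A *m B]mulmxA AB mulmx1 mulmxV.
Qed.

Lemma congr_acc M A B X : M \in unitmx -> A *m B = 1%:M ->
  M *m (A *m X) *m M^T *m invmx (M *m A *m M^T) *m (M *m (A *m X) *m M^T) =
  M *m (A *m X *m X) *m M^T.
Proof.
move=> uM AB; rewrite (congr_inv uM AB) !mulmxA mulmxK ?unitmx_tr // mulmxKV //.
by rewrite -[_ *m B *m A]mulmxA (mulmx1C AB) mulmx1.
Qed.

(** For a one-parameter group c^-1 c' is constant, and congruences preserve the
    geodesic equation. *)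
Lemma geo_exp M Q d : M \in unitmx -> Q *m Q^T = 1%:M ->
  geodesic (fun t => M *m spectral_exp Q (t *: d) *m M^T)
    (fun t => M *m (spectral_exp Q (t *: d) *m (Q *m diag_mx d *m Q^T)) *m M^T).
Proof.
move=> uM QQ; split=> t.
- exact/posdef_congr/spectral_exp_posdef.
- by apply: is_derive_rmulmx; apply: is_derive_lmulmx; exact: is_derive_spectral_exp.
have h := is_derive_rmulmx M^T (is_derive_lmulmx M (is_derive_rmulmx (Q *m diag_mx d *m Q^T)
  (is_derive_spectral_exp d t QQ))).
by apply: is_derive_eq h _; rewrite (congr_acc _ uM (spectral_expNr (t *: d) QQ)).
Qed.

Lemma geo_through A B : P A -> P B -> exists c c1, [/\ geodesic c c1, c 0 = A & c 1 = B].
Proof.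
move=> PA PB; have [M uM AE] := posdef_factor PA.
have [Q [d [QQ BE]]] : exists Q d, Q *m Q^T = 1%:M /\
   invmx M *m B *m (invmx M)^T = spectral_exp Q d.
  by apply: posdef_spectral_exp; apply: posdef_congr; rewrite // unitmx_inv.
exists (fun t => M *m spectral_exp Q (t *: d) *m M^T), (fun t => M *m (spectral_exp Q (t *: d) *m (Q *m diag_mx d *m Q^T)) *m M^T).
split; first exact: geo_exp.
  by rewrite scale0r spectral_exp0 // mulmx1.
rewrite scale1r -BE !mulmxA mulmxV // mul1mx -mulmxA -trmx_mul mulmxV //.
by rewrite trmx1 mulmx1.
Qed.

(** The exponential curve with opposite velocity is an inverse of c, because c^-1 c'
    is constant. *)
Lemma geo_from1 c c1 Q d : geodesic c c1 -> c 0 = 1%:M -> Q *m Q^T = 1%:M ->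
  c1 0 = Q *m diag_mx d *m Q^T -> forall t, c t = spectral_exp Q (t *: d).
Proof.
move=> gc c0 QQ cX t.
have h : forall s t, c s *m spectral_exp Q (- (s *: d)) = c t *m spectral_exp Q (- (t *: d)).
  apply: (is_derive0_cst (c := fun s => c s *m spectral_exp Q (- (s *: d)))) => s.
  have he := is_derive_spectral_exp (- d) s QQ.
  have h1 : is_derive s 1 (fun s => spectral_exp Q (- (s *: d))) (- ((Q *m diag_mx d *m Q^T) *m spectral_exp Q (- (s *: d)))).
    under eq_fun do rewrite -scalerN.
    apply: is_derive_eq he _; rewrite scalerN raddfN /= mulmxN mulNmx mulmxN; congr (- _).
    by rewrite spectral_exp_commute.
  apply: is_derive_eq (is_derive_mulmx (geo_vel gc s) h1) _.
  by rewrite (geo_left gc s) c0 invmx1 mul1mx cX mulmxN !mulmxA subrr.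
have := h t 0; rewrite scale0r oppr0 spectral_exp0 // mulmx1 c0 => e.
by rewrite -[RHS]mul1mx -e -mulmxA spectral_expNl // mulmx1.
Qed.

Variable L : 'M[R]_n -> 'M[R]_n.
Hypothesis isoL : trace_isometry L.

Local Notation F := (fun V A => 'D_V L A).

(** The inverse diffeomorphism provides a curve whose image under L is a straight
    line with direction X. *)
Lemma iso_surj A X : P A -> S X -> exists2 V, S V & F V A = X.
Proof.
move=> PA sX; case: (isoL) => -[LP _ [g [gP sg] [gK Kg]]] _.
have PB := LP _ PA; set B := L A in PB.
have gB : g B = A by apply: gK; rewrite mem_set.
have [_ /(_ X sX) [dg _]] := sg 1%N.
have nearB := posdef_line PB sX.
have hc := (is_derive_lineP g B X _).1 (derivableP (dg B PB)).
set w := 'D_X g B in hc.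
have near_g : \forall h \near (0 : R), P (g (h *: X + B)).
  by apply: filterS nearB => h; exact: gP.
have sw : S w by apply: is_derive_Symm hc; apply: filterS near_g => h [].
exists w => //.
have h1 := chain_rule_mx (iso_C1 isoL) near_g hc sw.
rewrite scale0r add0r gB in h1.
apply: (is_derive_unique h1).
have hl : is_derive (0 : R) 1 (fun h : R => h *: X + B) X.
  exact: (is_derive_lineP (fun A => A) B X X).1.
apply: near_eq_is_derive hl; apply: filterS nearB => h Ph.
by apply/esym/Kg; rewrite mem_set.
Qed.

Lemma is_derive_scalemx (k : R -> R) c t k' V : is_derive t 1 k k' ->
  is_derive t 1 c V -> is_derive t 1 (fun s => k s *: c s) (k' *: c t + k t *: V).
Proof.
move=> hk /is_derive_mxP hc; apply/is_derive_mxP => i j; rewrite !mxE.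
by under eq_fun do rewrite mxE; exact: is_derive_mulf.
Qed.

Lemma iso_hessianE A V : P A -> S V ->
  'D_V (F V) A = \sum_i \sum_j V i j *: 'D_V (F (symdelta R i j)) A.
Proof.
move=> PA sV; apply: (is_derive_unique (iso_line2 isoL PA sV sV)).
have h : is_derive (0 : R) 1
    (fun h : R => \sum_i \sum_j V i j *: F (symdelta R i j) (h *: V + A))
    (\sum_i \sum_j V i j *: 'D_V (F (symdelta R i j)) A).
  apply: is_derive_sumf => i; apply: is_derive_sumf => j.
  exact: is_deriveZ (iso_line2 isoL PA (symdelta_sym R i j) sV).
apply: near_eq_is_derive h; apply: filterS (posdef_line PA sV) => h Ph.
exact/esym/(derive_dirE_mx (iso_C1 isoL) Ph sV).
Qed.

(** The velocity of L o c is a combination, with moving coefficients, of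
    derivatives of L in fixed directions, so it can be differentiated by the chain
    rule. By iso_hessian the defect in the geodesic equation of L o c is orthogonal to
    the image of the differential, which consists of all symmetric matrices. *)
Lemma iso_geodesic c c1 : geodesic c c1 ->
  geodesic (fun t => L (c t)) (fun t => F (c1 t) (c t)).
Proof.
move=> gc; have Pc := geo_pos gc; have sc := geo_symm gc.
split=> t; first exact: iso_fun.
  apply: chain_rule_mx (geo_vel gc t) (sc t); first exact: iso_C1.
  exact: near_everywhere.
set A := c t; set V := c1 t; set V' := V *m invmx A *m V.
have PA : P A := Pc t; have sV : S V := sc t.
have sV' : S V'.
  have /SymmE sVt := sV; apply/SymmE.
  by rewrite /V' !trmx_mul trmx_inv sVt (posdef_sym PA) mulmxA.
have h : is_derive t 1 (fun s => F (c1 s) (c s)) (F V' A + 'D_V (F V) A).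
  have -> : (fun s => F (c1 s) (c s)) =
      (fun s => \sum_i \sum_j c1 s i j *: F (symdelta R i j) (c s)).
    by apply/funext => s; exact: derive_dirE_mx (iso_C1 isoL) (Pc s) (sc s).
  rewrite (derive_dirE_mx (iso_C1 isoL) PA sV') (iso_hessianE PA sV) -big_split /=.
  apply: is_derive_sumf => i; rewrite -big_split /=; apply: is_derive_sumf => j.
  have /is_derive_mxP /(_ i j) hij := geo_acc gc t.
  have near_c : \forall s \near t, P (c s) by exact: near_everywhere.
  have hF := chain_rule_mx (iso_C2 isoL (symdelta_sym R i j)) near_c (geo_vel gc t) (sc t).
  exact: (is_derive_scalemx hij hF).
apply: is_derive_eq h _.
set Y := _ *m _ *m _.
have sF W : S W -> S (F W A) by exact: iso_derive_Symm.
have sY : S Y.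
  have /SymmE sVt := sF _ sV; apply/SymmE.
  by rewrite /Y !trmx_mul trmx_inv sVt (posdef_sym (iso_fun isoL PA)) mulmxA.
set Z := F V' A + 'D_V (F V) A.
have sZ : S (Z - Y).
  by apply: SymmB => //; apply: SymmD; [exact: sF | exact: iso_derive2_Symm].
have orth W : S W -> trace_metric (L A) (Z - Y) (F W A) = 0.
  move=> sW; rewrite trace_metricBl trace_metricDl iso_metric // iso_hessian //.
  have -> : trace_metric A V' W = cubic_trace A V V W by rewrite /trace_metric /V' /cubic_trace !mulmxA.
  have -> : trace_metric (L A) Y (F W A) = cubic_trace (L A) (F V A) (F V A) (F W A).
    by rewrite /trace_metric /Y /cubic_trace !mulmxA.
  by rewrite addrCA subrr addr0 subrr.
have [W sW WE] := iso_surj PA sZ.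
apply/eqP; rewrite -subr_eq0; apply/eqP.
by apply: (trace_metric_def (iso_fun isoL PA) sZ); rewrite -{2}WE; exact: orth.
Qed.

(** Isometries commute with geodesic symmetries: apply geo_reflect to a geodesic
    from A to B and to its image. *)
Lemma iso_reflect A B : P A -> P B ->
  L (A *m invmx B *m A) = L A *m invmx (L B) *m L A.
Proof.
move=> PA PB; have [c [c1 [gc c0 cB]]] := geo_through PA PB.
have refl c' c1' : geodesic c' c1' -> c' (-1) = c' 0 *m invmx (c' 1) *m c' 0.
  move=> gc'; have u s := posdef_unit (geo_pos gc' s).
  have e := geo_reflect gc' 1.
  have -> : c' 0 *m invmx (c' 1) = c' (-1) *m invmx (c' 0) by rewrite -{1}e mulmxK.
  by rewrite mulmxKV.
by have := refl _ _ (iso_geodesic gc); rewrite (refl _ _ gc) c0 cB.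
Qed.

End Geodesics.

(** * An isometry that fixes the identity *)

Section Normalised.
Variables (R : realType) (n : nat).
Implicit Types (A B M V W U X Y Z Q : 'M[R]_n) (d : 'rV[R]_n) (c : R -> 'M[R]_n) (t : R).

Local Notation P := (posdefmx R n).
Local Notation S := (Symm R n).

Lemma geo_congr M c c1 : M \in unitmx -> geodesic c c1 ->
  geodesic (fun t => M *m c t *m M^T) (fun t => M *m c1 t *m M^T).
Proof.
move=> uM gc; split=> t.
- exact: posdef_congr uM (geo_pos gc t).
- by apply: is_derive_rmulmx; apply: is_derive_lmulmx; exact: geo_vel.
have h := is_derive_rmulmx M^T (is_derive_lmulmx M (geo_acc gc t)).
apply: is_derive_eq h _.
have uc := posdef_unit (geo_pos gc t).
have := congr_acc (invmx (c t) *m c1 t) uM (mulmxV uc).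
by rewrite mulKVmx // !mulmxA => ->.
Qed.

Variable L : 'M[R]_n -> 'M[R]_n.
Hypothesis isoL : trace_isometry L.
Variable N : 'M[R]_n.
Hypotheses (uN : N \in unitmx) (LN : L 1%:M = N *m N^T).

Let K := invmx N.
Let uK : K \in unitmx. Proof. by rewrite unitmx_inv. Qed.

(** The isometry A |-> N^-1 L(A) N^-T, which fixes the identity because
    L 1 = N N^T. *)
Definition normalized A := K *m L A *m K^T.
Definition normalized_derive V A := K *m 'D_V L A *m K^T.
Local Notation T := (normalized_derive^~ 1%:M).

Lemma normalized_pos A : P A -> P (normalized A).
Proof. by move=> PA; apply: posdef_congr uK (iso_fun isoL PA). Qed.

Lemma normalized1 : normalized 1%:M = 1%:M.
Proof.
rewrite /normalized LN mulmxA mulVmx // mul1mx -trmx_mul.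
by rewrite mulVmx // trmx1.
Qed.

Lemma normalizedK A : L A = N *m normalized A *m N^T.
Proof. by rewrite /normalized !mulmxA mulmxV // mul1mx -mulmxA -trmx_mul mulmxV // trmx1 mulmx1. Qed.

Lemma normalized_reflect A B : P A -> P B ->
  normalized (A *m invmx B *m A) = normalized A *m invmx (normalized B) *m normalized A.
Proof.
move=> PA PB; rewrite /normalized iso_reflect //.
have uB := posdef_unit (iso_fun isoL PB).
rewrite (congr_inv uK (mulmxV uB)) !mulmxA mulmxK ?unitmx_tr //.
by rewrite mulmxKV.
Qed.

Lemma normalized_inv A : P A -> normalized (invmx A) = invmx (normalized A).
Proof.
move=> PA; have := normalized_reflect (posdef1 R n) PA.
by rewrite normalized1 !mul1mx !mulmx1.
Qed.

Lemma normalized_triple A B : P A -> P B -> normalized (A *m B *m A) = normalized A *m normalized B *m normalized A.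
Proof.
move=> PA PB; rewrite -[in LHS](invmxK B) normalized_reflect //; last exact: posdef_inv.
by rewrite normalized_inv // invmxK.
Qed.

Lemma posdef_sandwich A B : P A -> P B -> P (A *m B *m A).
Proof.
by move=> PA PB; rewrite -{2}(posdef_sym PA); apply: posdef_congr (posdef_unit PA) PB.
Qed.

Lemma normalized_sq A : P A -> normalized (A *m A) = normalized A *m normalized A.
Proof.
by move=> PA; have := normalized_triple PA (posdef1 R n); rewrite normalized1 !mulmx1.
Qed.

Lemma posdef_sq A : P A -> P (A *m A).
Proof. by move=> PA; have := posdef_sandwich PA (posdef1 R n); rewrite mulmx1. Qed.

(** Both sides are the values at 1 of geodesics that start at the identity with
    the same velocity. *)
Lemma normalized_exp Q d Q' d' : Q *m Q^T = 1%:M -> Q' *m Q'^T = 1%:M ->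
  T (Q *m diag_mx d *m Q^T) = Q' *m diag_mx d' *m Q'^T ->
  normalized (spectral_exp Q d) = spectral_exp Q' d'.
Proof.
move=> QQ QQ' hT.
have g1 := geo_exp d (unitmx1 R n) QQ.
have g2 := geo_congr uK (iso_geodesic isoL g1).
have c0 : (1%:M : 'M[R]_n) *m spectral_exp Q (0 *: d) *m 1%:M^T = 1%:M.
  by rewrite scale0r spectral_exp0 // trmx1 !mulmx1.
have e1 : normalized (1%:M *m spectral_exp Q (0 *: d) *m 1%:M^T) = 1%:M by rewrite c0 normalized1.
have v0 : (1%:M : 'M[R]_n) *m (spectral_exp Q (0 *: d) *m (Q *m diag_mx d *m Q^T)) *m 1%:M^T =
    Q *m diag_mx d *m Q^T.
  by rewrite scale0r spectral_exp0 // trmx1 !mul1mx mulmx1.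
have e2 : normalized_derive (1%:M *m (spectral_exp Q (0 *: d) *m (Q *m diag_mx d *m Q^T)) *m 1%:M^T)
    (1%:M *m spectral_exp Q (0 *: d) *m 1%:M^T) = Q' *m diag_mx d' *m Q'^T.
  by rewrite c0 v0.
have := geo_from1 g2 e1 QQ' e2 1.
by rewrite !scale1r mul1mx trmx1 mulmx1.
Qed.

Lemma normalized_curve c t V : (\forall s \near t, P (c s)) -> is_derive t 1 c V -> S V ->
  is_derive t 1 (fun s => normalized (c s)) (normalized_derive V (c t)).
Proof.
move=> Pc hc sV; apply: is_derive_rmulmx; apply: is_derive_lmulmx.
exact: chain_rule_mx (iso_C1 isoL) Pc hc sV.
Qed.

Lemma line_derive A V : is_derive (0 : R) 1 (fun h : R => h *: V + A) V.
Proof. exact: (is_derive_lineP (fun B => B) A V V).1. Qed.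

(** Differentiate normalized_triple in its inner argument at the identity. *)
Lemma normalized_derive_sandwich A Y : P A -> S Y ->
  normalized_derive (A *m Y *m A) (A *m A) = normalized A *m T Y *m normalized A.
Proof.
move=> PA sY; have sA := posdef_sym PA.
have sAYA : S (A *m Y *m A) by rewrite -{2}sA; exact: SymmC.
have nP := posdef_line (posdef1 R n) sY.
have E (h : R) : h *: (A *m Y *m A) + A *m A = A *m (h *: Y + 1%:M) *m A.
  by rewrite mulmxDr mulmxDl mulmx1 -scalemxAr -scalemxAl.
have near1 : \forall h \near (0 : R), P (h *: (A *m Y *m A) + A *m A).
  by apply: filterS nP => h Ph; rewrite E; exact: posdef_sandwich.
have h1 := normalized_curve near1 (line_derive _ _) sAYA.
have h2 := normalized_curve nP (line_derive _ _) sY.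
have h3 := is_derive_rmulmx (normalized A) (is_derive_lmulmx (normalized A) h2).
rewrite scale0r add0r in h1; rewrite scale0r add0r in h3.
apply: is_derive_unique h1 _; apply: near_eq_is_derive h3.
by apply: filterS nP => h Ph; rewrite E normalized_triple.
Qed.

(** Differentiate normalized_sq; the argument A A moves along a curve that is not a
    line, which needs the chain rule. *)
Lemma normalized_derive_sq A Z : P A -> S Z ->
  normalized_derive (Z *m A + A *m Z) (A *m A) = normalized_derive Z A *m normalized A + normalized A *m normalized_derive Z A.
Proof.
move=> PA sZ; have sA := posdef_sym PA.
have sZA : S (Z *m A + A *m Z).
  by apply/SymmE; rewrite linearD /= !trmx_mul sA ((SymmE _).1 sZ) addrC.
have nP := posdef_line PA sZ; have hl := line_derive A Z.
have near2 : \forall h \near (0 : R), P ((h *: Z + A) *m (h *: Z + A)).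
  by apply: filterS nP => h; exact: posdef_sq.
have hc := is_derive_mulmx hl hl.
rewrite scale0r add0r in hc.
have h1 := normalized_curve near2 hc sZA.
have h2 := normalized_curve nP hl sZ; have h3 := is_derive_mulmx h2 h2.
rewrite scale0r add0r in h1; rewrite scale0r add0r in h3.
apply: is_derive_unique h1 _; apply: near_eq_is_derive h3.
by apply: filterS nP => h Ph; rewrite normalized_sq.
Qed.

Lemma sandwich_cancel A X Y : A \in unitmx ->
  A *m A *m X *m (A *m A) = A *m Y *m A *m (A *m A) + A *m A *m (A *m Y *m A) ->
  X = A *m Y *m invmx A + invmx A *m Y *m A.
Proof.
move=> uA e; have uAA : A *m A \in unitmx by rewrite unitmx_mul uA.
have -> : X = invmx (A *m A) *m (A *m A *m X *m (A *m A)) *m invmx (A *m A).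
  by rewrite -[A *m A *m X *m _]mulmxA mulKmx // mulmxK.
have -> : invmx (A *m A) = invmx A *m invmx A.
  by apply: mulmx1_inv; rewrite mulmxA mulmxK // mulmxV.
rewrite e mulmxDr mulmxDl !mulmxA [LHS]addrC; congr (_ + _).
  by rewrite mulmxKV // mulVmx // mul1mx mulmxK.
by rewrite mulmxKV // mulmxK // mulmxK.
Qed.

(** Take A = B B and Z = B Y B in normalized_derive_sq. Both sides then involve
    derivatives of the shape handled by normalized_derive_sandwich, and the outer
    factors cancel. *)
Lemma normalized_derive_cosh B Y : P B -> S Y ->
  T (B *m Y *m invmx B + invmx B *m Y *m B) =
  normalized B *m T Y *m invmx (normalized B) + invmx (normalized B) *m T Y *m normalized B.
Proof.
move=> PB sY; have sB := posdef_sym PB; have uB := posdef_unit PB.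
set C := normalized B; have uC : C \in unitmx by exact/posdef_unit/normalized_pos.
set Y' := _ + _.
have sY' : S Y'.
  apply/SymmE; rewrite /Y' linearD /= !trmx_mul trmx_inv sB ((SymmE _).1 sY).
  by rewrite !mulmxA addrC.
pose A := B *m B; have PA : P A := posdef_sq PB.
pose Z := B *m Y *m B; have sZ : S Z by rewrite /Z -{2}sB; exact: SymmC.
have AC : normalized A = C *m C by exact: normalized_sq.
have h1 := normalized_derive_sandwich PA sY'; have h2 := normalized_derive_sq PA sZ.
have ZA : Z *m A + A *m Z = A *m Y' *m A.
  rewrite /Y' /Z /A mulmxDr mulmxDl !mulmxA addrC; congr (_ + _).
    by rewrite mulmxKV.
  by rewrite mulmxK.
rewrite ZA h1 (normalized_derive_sandwich PB sY : normalized_derive Z A = _) AC -/C in h2.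
exact: sandwich_cancel uC h2.
Qed.

Theorem normalized_derive_cosh_map : cosh_map T.
Proof.
have P1 := posdef1 R n; have C1L := iso_C1 isoL.
split.
- split=> [V sV|V W sV sW|k V sV]; rewrite /normalized_derive.
  + exact/SymmC/iso_derive_Symm.
  + by rewrite derive_dirD_mx // mulmxDr mulmxDl.
  + by rewrite derive_dirZ_mx // -scalemxAr -scalemxAl.
- move=> V W sV sW; have := iso_metric isoL P1 sV sW.
  rewrite /trace_metric invmx1 !mul1mx mulmx1 => <-; rewrite LN.
  have -> : invmx (N *m N^T) = K^T *m K.
    by apply: mulmx1_inv; rewrite mulmxA -[_ *m _ *m K^T]mulmxA -trmx_mul mulVmx // trmx1 mulmx1 mulmxV.
  have cyc X Y : \tr (K *m X *m K^T *m (K *m Y *m K^T)) = \tr (K^T *m K *m X *m (K^T *m K) *m Y).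
    by rewrite !mulmxA [LHS]mxtrace_mulC !mulmxA.
  exact: cyc.
- move=> V sV.
  have [W sW WE] := iso_surj isoL P1 (SymmC N sV).
  exists W => //; rewrite /normalized_derive WE !mulmxA mulVmx // mul1mx -mulmxA -trmx_mul.
  by rewrite mulVmx // trmx1 mulmx1.
- move=> Q d Q' d' QQ QQ' hT Y sY.
  have := normalized_derive_cosh (spectral_exp_posdef d QQ) sY.
  by rewrite (normalized_exp QQ QQ' hT) !spectral_exp_inv.
Qed.

End Normalised.

(** * Every isometry has one of the four forms *)

Section Forward.
Variables (R : realType) (n : nat).
Hypothesis n_gt1 : (1 < n)%N.

(** The traces and signs of cosh_map_classification, seen through the exponential. *)
Lemma spectral_power (A Q : 'M[R]_n) (d : 'rV[R]_n) (e : bool) (k : R) :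
  Q *m Q^T = 1%:M -> A = spectral_exp Q d ->
  spectral_exp Q ((-1) ^+ e *: d + const_mx (k * \sum_i d 0 i)) =
  `|\det A| `^ k *: (if e then invmx A else A).
Proof.
move=> QQ ->; rewrite spectral_exp_det // gtr0_norm ?expR_gt0 // -expRM [_ * k]mulrC.
have -> : (if e then invmx (spectral_exp Q d) else spectral_exp Q d) = spectral_exp Q ((-1) ^+ e *: d).
  by case: e; rewrite ?expr1 ?expr0 ?scaleN1r ?scale1r ?spectral_exp_inv.
rewrite /spectral_exp scalemxAl scalemxAr; congr (_ *m _ *m _); apply/matrixP => i j.
by rewrite !mxE; case: (i == j); rewrite ?mulr0n ?mulr1n ?mulr0 // expRD [LHS]mulrC.
Qed.

(** Every positive definite matrix is an exponential, so normalized_exp and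
    cosh_map_classification determine L. *)
Theorem isometry_form (L : 'M[R]_n -> 'M[R]_n) : trace_isometry L ->
  exists M (e : bool) k, [/\ M \in unitmx, k = 0 \/ k = - (2 * (-1) ^+ e) / n%:R &
    forall A, posdefmx R n A ->
      L A = M *m (`|\det A| `^ k *: (if e then invmx A else A)) *m M^T].
Proof.
move=> isoL; have [N uN LN] := posdef_factor (iso_fun isoL (posdef1 R n)).
have [Q [s [k [QQ se ke TE]]]] := cosh_map_classification n_gt1 (normalized_derive_cosh_map isoL uN LN).
have [e eE] : exists e : bool, s = (-1) ^+ e.
  by case: se => ->; [exists false | exists true]; rewrite ?expr0 ?expr1.
exists (N *m Q), e, k; split; rewrite -?eE //.
  by rewrite unitmx_mul uN ortho_unit.
move=> A PA; have [Q0 [d [QQ0 AE]]] := posdef_spectral_exp PA.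
suff key : normalized L N A = Q *m (`|\det A| `^ k *: (if e then invmx A else A)) *m Q^T.
  by rewrite (normalizedK L uN) key trmx_mul !mulmxA.
have QQ' : (Q *m Q0) *m (Q *m Q0)^T = 1%:M.
  by rewrite trmx_mul mulmxA mulmx_orthoK.
have sV : Symm R n (Q0 *m diag_mx d *m Q0^T).
  by apply/SymmC/SymmE; rewrite tr_diag_mx.
rewrite -(spectral_power e k QQ0 AE) AE.
rewrite (normalized_exp isoL uN LN (Q' := Q *m Q0) (d' := (-1) ^+ e *: d + const_mx (k * \sum_i d 0 i)) QQ0 QQ').
  by rewrite /spectral_exp trmx_mul !mulmxA.
rewrite TE // trmx_mul mulmxA -!mulmxA; congr (Q *m _); rewrite !mulmxA; congr (_ *m _).
rewrite raddfD /= mulmxDr mulmxDl; congr (_ + _).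
  by rewrite eE linearZ /= -scalemxAr -scalemxAl.
rewrite diag_const_mx mul_mx_scalar -scalemxAl QQ0 scalemx1; congr (_ * _)%:M.
by rewrite mxtrace_mulC ortho_mulmxTK // mxtrace_diag.
Qed.

End Forward.

(** * Smoothness of explicit maps *)

Section Smoothness.
Variables (R : realType) (n : nat).
Implicit Types (A M V W : 'M[R]_n) (h : 'M[R]_n -> 'M[R]_n).

Local Notation P := (posdefmx R n).
Local Notation S := (Symm R n).

(** An algebra of explicit scalar functions that is closed under directional
    derivatives. Determinants are polynomials in the entries, and real powers of
    positive functions give powers of determinants and entries of inverse matrices. *)
Inductive elementary : ('M[R]_n -> R) -> Prop :=
| elementary_cst k : elementary (fun=> k)
| elementary_entry i j : elementary (fun A => A i j)
| elementary_add f g : elementary f -> elementary g -> elementary (fun A => f A + g A)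
| elementary_mul f g : elementary f -> elementary g -> elementary (fun A => f A * g A)
| elementary_pow f k : elementary f -> (forall A, P A -> 0 < f A) -> elementary (fun A => f A `^ k).

Lemma elementary_sum (I : finType) (f : I -> 'M[R]_n -> R) :
  (forall i, elementary (f i)) -> elementary (fun A => \sum_i f i A).
Proof.
move=> nf; elim: (index_enum I) => [|i s IH].
  by under eq_fun do rewrite big_nil; exact: elementary_cst.
by under eq_fun do rewrite big_cons; exact: elementary_add.
Qed.

Lemma elementary_prod (I : finType) (f : I -> 'M[R]_n -> R) :
  (forall i, elementary (f i)) -> elementary (fun A => \prod_i f i A).
Proof.
move=> nf; elim: (index_enum I) => [|i s IH].
  by under eq_fun do rewrite big_nil; exact: elementary_cst.
by under eq_fun do rewrite big_cons; exact: elementary_mul.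
Qed.

Lemma elementary_det m (h : 'M[R]_n -> 'M[R]_m) :
  (forall i j, elementary (fun A => h A i j)) -> elementary (fun A => \det (h A)).
Proof.
move=> nh; apply: (@elementary_sum {perm 'I_m} (fun (s : {perm 'I_m}) A => (-1) ^+ s * \prod_i h A i (s i))) => s.
apply: elementary_mul; first exact: elementary_cst.
by apply: (@elementary_prod _ (fun i A => h A i (s i))).
Qed.

Lemma is_derive_pow (f : 'M[R]_n -> R) A V D (k : R) : 0 < f A ->
  is_derive A V f D -> is_derive A V (fun B => f B `^ k) (k * f A `^ (k - 1) * D).
Proof.
move=> fA /is_derive_lineP hf; apply/is_derive_lineP.
have f0 : 0 < f (0 *: V + A) by rewrite scale0r add0r.
have := @is_derive1_comp R (fun x => x `^ k) _ (0 : R) _ _ (is_derive1_powR k f0) hf.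
by rewrite scale0r add0r.
Qed.

Lemma elementary_derive f V : elementary f ->
  exists2 g, elementary g & forall A, P A -> is_derive A V f (g A).
Proof.
elim=> {f} [k|i j|f f' nf [g ng hg] nf' [g' ng' hg']|f f' nf [g ng hg] nf' [g' ng' hg']|f k nf [g ng hg] fpos].
- by exists (fun=> 0); [exact: elementary_cst | move=> A _; exact: is_derive_cst].
- exists (fun=> V i j); first exact: elementary_cst.
  by move=> A _; have /is_derive_mxP := is_derive_id A V; apply.
- exists (fun A => g A + g' A); first exact: elementary_add.
  by move=> A PA; exact: is_deriveD (hg A PA) (hg' A PA).
- exists (fun A => g A * f' A + f A * g' A); first by apply: elementary_add; exact: elementary_mul.
  by move=> A PA; exact: is_derive_mulf (hg A PA) (hg' A PA).
- exists (fun A => k * f A `^ (k - 1) * g A).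
    apply: elementary_mul => //; apply: elementary_mul; first exact: elementary_cst.
    exact: elementary_pow.
  by move=> A PA; exact: is_derive_pow (fpos A PA) (hg A PA).
Qed.

Lemma elementary_continuous f A : elementary f -> P A -> f @ A --> f A.
Proof.
move=> nf PA; elim: nf => {f} [k|i j|f g _ cf _ cg|f g _ cf _ cg|f k _ cf fpos].
- by apply: cvg_cst; exact: nbhs_filter.
- exact: (@coord_continuous R n n i j A).
- exact: (@cvgD _ _ _ (nbhs A) (nbhs_filter A) f g _ _ cf cg).
- exact: (@cvgM _ _ (nbhs A) (nbhs_filter A) f g _ _ cf cg).
- have cp : (fun x : R => x `^ k) @ f A --> f A `^ k.
    exact: is_derive1_continuous (is_derive1_powR k (fpos A PA)).
  exact: cvg_comp cf cp.
Qed.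

(** Equality is only required on the cone, since the inverse of a matrix is given by
    cofactors there, and the cone is open in the directions that matter. *)
Definition elementarymx h := forall i j, exists2 g, elementary g & forall A, P A -> h A i j = g A.

Lemma elementarymx_line h V : elementarymx h -> S V -> exists2 h', elementarymx h' &
  forall A, P A -> is_derive A V h (h' A).
Proof.
move=> nh sV.
have H i j : exists g, elementary g /\ forall A, P A -> is_derive A V (fun A => h A i j) (g A).
  have [f nf hf] := nh i j; have [g ng hg] := elementary_derive V nf.
  exists g; split=> // A PA.
  have hl := (is_derive_lineP f A V _).1 (hg A PA).
  apply: (is_derive_lineP _ A V _).2; apply: near_eq_is_derive hl.
  by apply: filterS (posdef_line PA sV) => t Pt; rewrite hf.
have /choice [g hg] : forall ij : 'I_n * 'I_n, exists g, elementary g /\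
    forall A, P A -> is_derive A V (fun A => h A ij.1 ij.2) (g A).
  by move=> [i j]; exact: H.
exists (fun A => \matrix_(i, j) g (i, j) A).
  by move=> i j; exists (g (i, j)); [have [] := hg (i, j) | move=> A _; rewrite mxE].
move=> A PA; apply/is_derive_mxP => i j; rewrite mxE.
by have [_ H'] := hg (i, j); exact: H'.
Qed.

Lemma elementarymx_ext h h' : (forall A, P A -> h A = h' A) -> elementarymx h -> elementarymx h'.
Proof.
move=> hh nh i j; have [g ng hg] := nh i j; exists g => // A PA.
by rewrite -hh // hg.
Qed.

Lemma elementarymx_continuous h : elementarymx h -> {within P, continuous h}.
Proof.
move=> nh; apply/subspace_continuousP => A PA; apply/cvgrPdist_le => e e0.
have H : forall i, \forall X \near A, forall j, P X -> `|h A i j - h X i j| <= e.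
  move=> i; apply: (@filter_forall _ _ (fun j X => P X -> `|h A i j - h X i j| <= e) (nbhs A) (nbhs_filter A)) => j.
  have [g ng hg] := nh i j.
  apply: filterS ((cvgrPdist_le _ _).1 (elementary_continuous ng PA) e e0) => X /= le PX.
  by rewrite !hg.
have {}H : \forall X \near A, forall i j, P X -> `|h A i j - h X i j| <= e.
  exact: (@filter_forall _ _ (fun i X => forall j, P X -> `|h A i j - h X i j| <= e) (nbhs A) (nbhs_filter A)).
rewrite near_withinE; apply: filterS H => X H PX.
rewrite /Num.Def.normr /= mx_normrE (bigmax_le _ (ltW e0)) //= => -[i j] _.
by rewrite !mxE; exact: H.
Qed.

(** Differentiation stays in the class and all its members are continuous. *)
Lemma elementarymx_smooth h : elementarymx h -> smooth S P h.
Proof.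
move=> nh k; elim: k h nh => [|k IH] h nh /=; split=> //; try exact: elementarymx_continuous.
move=> V sV; have [h' nh' hh'] := elementarymx_line nh sV; split.
  by move=> A PA; have [] := hh' A PA.
apply: IH; apply: elementarymx_ext nh' => A PA.
by have [_ ->] := hh' A PA.
Qed.

Lemma elementarymx_id : elementarymx id.
Proof. by move=> i j; exists (fun A => A i j) => //; exact: elementary_entry. Qed.

Lemma elementarymx_mul h h' : elementarymx h -> elementarymx h' -> elementarymx (fun A => h A *m h' A).
Proof.
move=> nh nh' i j.
have /choice [f hf] : forall l, exists f, elementary f /\ forall A, P A -> h A i l * h' A l j = f A.
  move=> l; have [f nf hf] := nh i l; have [f' nf' hf'] := nh' l j.
  exists (fun A => f A * f' A); split; first exact: elementary_mul.
  by move=> A PA; rewrite hf // hf'.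
exists (fun A => \sum_l f l A); first by apply: elementary_sum => l; have [] := hf l.
by move=> A PA; rewrite mxE; apply: eq_bigr => l _; have [_ ->] := hf l.
Qed.

Lemma elementarymx_cst M : elementarymx (fun=> M).
Proof. by move=> i j; exists (fun=> M i j) => //; exact: elementary_cst. Qed.

Lemma elementarymx_repr h : elementarymx h -> exists2 h' : 'M[R]_n -> 'M[R]_n,
  (forall i j, elementary (fun A => h' A i j)) & forall A, P A -> h A = h' A.
Proof.
move=> nh.
have /choice [g hg] : forall ij : 'I_n * 'I_n, exists g, elementary g /\
    forall A, P A -> h A ij.1 ij.2 = g A.
  by move=> [i j]; have [g ng hg] := nh i j; exists g.
exists (fun A => \matrix_(i, j) g (i, j) A).
  by move=> i j; under eq_fun do rewrite mxE; have [] := hg (i, j).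
by move=> A PA; apply/matrixP => i j; rewrite mxE; have [_ <-] := hg (i, j).
Qed.

(** All four forms of the theorem are congruences of such maps. *)
Definition det_power_map (e : bool) (k : R) A : 'M[R]_n :=
  `|\det A| `^ k *: (if e then invmx A else A).

Lemma elementarymx_det_power_map h e k : elementarymx h -> (forall A, P A -> P (h A)) ->
  elementarymx (fun A => det_power_map e k (h A)).
Proof.
move=> nh hP; have [h' nh' hh'] := elementarymx_repr nh.
have h'P A : P A -> P (h' A) by move=> PA; rewrite -hh' //; exact: hP.
have ndet := elementary_det nh'.
have dpos A : P A -> 0 < \det (h' A) by move=> /h'P /posdef_det.
have npow l : elementary (fun A => \det (h' A) `^ l) by exact: elementary_pow.
move=> i j; case: e.
  exists (fun A => \det (h' A) `^ k * (\det (h' A) `^ (-1) *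
      ((-1) ^+ (j + i) * \det (row' j (col' i (h' A)))))).
    apply: elementary_mul => //; apply: elementary_mul => //; apply: elementary_mul; first exact: elementary_cst.
    apply: elementary_det => p q; under eq_fun do rewrite !mxE; exact: nh'.
  move=> A PA; have d0 := dpos A PA; rewrite hh' // /det_power_map mxE gtr0_norm //; congr (_ * _).
  rewrite powR_inv1 ?ltW // /invmx (posdef_unit (h'P A PA)) mxE; congr (_ * _).
  by rewrite mxE.
exists (fun A => \det (h' A) `^ k * h' A i j); first exact: elementary_mul.
by move=> A PA; have d0 := dpos A PA; rewrite hh' // /det_power_map mxE gtr0_norm.
Qed.

End Smoothness.

(** * The four forms are isometries *)

Section Explicit.
Variables (R : realType) (n : nat).
Implicit Types (A M V W Q : 'M[R]_n).

Local Notation P := (posdefmx R n).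
Local Notation S := (Symm R n).

Lemma is_derive_prod1 (I : finType) (w : I -> R) :
  is_derive (0 : R) 1 (fun h : R => \prod_i (1 + h * w i)) (\sum_i w i).
Proof.
elim: (index_enum I) => [|i s IH].
  by under eq_fun do rewrite big_nil; rewrite big_nil; exact: is_derive_cst.
under eq_fun do rewrite big_cons; rewrite big_cons.
have hl : is_derive (0 : R) 1 (fun h : R => 1 + h * w i) (w i).
  have h1 : is_derive (0 : R) 1 (fun h : R => h * w i) (1 * w i + 0 * 0).
    exact: is_derive_mulf (is_derive_id _ _) (is_derive_cst (w i) (0 : R) (1 : R)).
  apply: is_derive_eq (is_deriveD (is_derive_cst (1 : R) (0 : R) (1 : R)) h1) _.
  by rewrite add0r mul1r mul0r addr0.
apply: is_derive_eq (is_derive_mulf hl IH) _.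
rewrite mul0r addr0 mul1r; congr (_ + _); rewrite big1 ?mulr1 //.
by move=> j _; rewrite mul0r addr0.
Qed.

(** Jacobi's formula, for symmetric directions: diagonalise A^-1 V up to
    conjugation; then the determinant is a product of affine functions of h. *)
Lemma is_derive_det A V : P A -> S V ->
  is_derive (0 : R) 1 (fun h : R => \det (h *: V + A)) (\det A * \tr (invmx A *m V)).
Proof.
move=> PA /SymmE sV; have [M uM AE] := posdef_factor PA; pose K := invmx M.
have uMT : M^T \in unitmx by rewrite unitmx_tr.
have KT : K^T = invmx M^T by rewrite /K trmx_inv.
have sW : (K *m V *m K^T)^T = K *m V *m K^T by rewrite !trmx_mul trmxK sV mulmxA.
have [Q [w [QQ WE]]] := symmetric_spectral sW.
have VE : V = M *m (Q *m diag_mx w *m Q^T) *m M^T.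
  by rewrite -WE /K KT !mulmxA mulmxV // mul1mx mulmxKV.
have hE : (fun h : R => \det (h *: V + A)) =
    (fun h : R => \det A * \prod_i (1 + h * w 0 i)).
  apply/funext => h.
  have -> : h *: V + A = M *m (Q *m diag_mx (const_mx 1 + h *: w) *m Q^T) *m M^T.
    rewrite raddfD /= diag_const_mx linearZ /= !(mulmxDr, mulmxDl) mulmx1 QQ mulmx1.
    by rewrite -AE addrC; congr (_ + _); rewrite {1}VE -!(scalemxAr, scalemxAl).
  rewrite !det_mulmx AE det_mulmx det_diag.
  have QQd : \det Q * \det Q^T = 1 by rewrite -det_mulmx QQ det1.
  have -> : \prod_i (const_mx 1 + h *: w) 0 i = \prod_i (1 + h * w 0 i).
    by apply: eq_bigr => i _; rewrite !mxE.
  set p := \prod_i _; transitivity ((\det Q * \det Q^T) * (\det M * \det M^T * p)); last by rewrite QQd mul1r.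
  by ring.
rewrite hE.
have hp := is_derive_prod1 (fun i => w 0 i).
have tE : \tr (invmx A *m V) = \sum_i w 0 i.
  have -> : invmx A = K^T *m K.
    apply: mulmx1_inv; rewrite AE mulmxA -[M *m M^T *m K^T]mulmxA -trmx_mul.
    by rewrite mulVmx // trmx1 mulmx1 mulmxV.
  rewrite -mulmxA mxtrace_mulC WE mxtrace_mulC ortho_mulmxTK //.
  by rewrite mxtrace_diag.
rewrite tE; apply: is_derive_eq (is_derive_mulf (is_derive_cst (\det A) (0 : R) (1 : R)) hp) _.
by rewrite mul0r add0r.
Qed.

Variables (e : bool) (k : R).
Local Notation s := ((-1) ^+ e : R).
Hypotheses (n_gt0 : (0 < n)%N) (ke : k = 0 \/ k = - (2 * s) / n%:R).

(* That the map is an involution and that it preserves the metric both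
   reduce to this equation. *)
Let k_quad : k * (2 * s + n%:R * k) = 0.
Proof.
case: ke => ->; first by rewrite mul0r.
have n0 : n%:R != 0 :> R by rewrite pnatr_eq0 -lt0n.
by rewrite [n%:R * _]mulrC divfK // subrr mulr0.
Qed.

(** On eigenvalues, the map is an affine change of logarithms. *)
Lemma det_power_map_pos A : P A -> P (det_power_map e k A).
Proof.
case/posdef_spectral_exp => Q [d [QQ AE]]; rewrite /det_power_map -(spectral_power e k QQ AE).
exact: spectral_exp_posdef.
Qed.

(** The choice of k makes the map an involution, so the inverse of a congruence of it
    has an explicit form of the same kind. *)
Lemma det_power_mapK A : P A -> det_power_map e k (det_power_map e k A) = A.
Proof.
case/posdef_spectral_exp => Q [d [QQ AE]].
rewrite {2}/det_power_map -(spectral_power e k QQ AE) /det_power_map -(spectral_power e k QQ (erefl _)) AE.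
have sumE (c : R) : \sum_i (s *: d + const_mx c) 0 i = s * \sum_i d 0 i + n%:R * c.
  under eq_bigr do rewrite !mxE.
  by rewrite big_split /= -mulr_sumr sumr_const card_ord mulr_natl.
rewrite sumE; congr spectral_exp; apply/rowP => i; rewrite !mxE.
set t := \sum_i _; have ss : s * s = 1 by rewrite -expr2 sqrr_sign.
transitivity (s * s * d 0 i + k * (2 * s + n%:R * k) * t); first by ring.
by rewrite ss k_quad mul1r mul0r addr0.
Qed.

Definition det_power_map_der A V : 'M[R]_n :=
  `|\det A| `^ k *: ((if e then - (invmx A *m V *m invmx A) else V)
    + (k * \tr (invmx A *m V)) *: (if e then invmx A else A)).

Lemma is_derive_det_power_map A V : P A -> S V ->
  is_derive A V (det_power_map e k) (det_power_map_der A V).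
Proof.
move=> PA sV; apply: (is_derive_lineP _ A V _).2.
have nP := posdef_line PA sV; have hd := is_derive_det PA sV.
have A0 : 0 < \det A := posdef_det PA.
have hpow : is_derive (0 : R) 1 (fun h : R => `|\det (h *: V + A)| `^ k)
    (k * \det A `^ k * \tr (invmx A *m V)).
  have d0 : 0 < \det (0 *: V + A) by rewrite scale0r add0r.
  have h1 := @is_derive1_comp R (fun x => x `^ k) _ (0 : R) _ _ (is_derive1_powR k d0) hd.
  rewrite scale0r add0r in h1.
  have h2 : is_derive (0 : R) 1 (fun h : R => \det (h *: V + A) `^ k)
      (k * \det A `^ k * \tr (invmx A *m V)).
    apply: is_derive_eq h1 _; rewrite !mulrA; congr (_ * _); rewrite -!mulrA; congr (_ * _).
    rewrite -{2}(powRr1 (ltW A0)) -powRD ?subrK //.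
    by rewrite (gt_eqF A0) implybT.
  apply: near_eq_is_derive h2; apply: filterS nP => h /posdef_det d.
  by rewrite gtr0_norm.
have hmat : is_derive (0 : R) 1 (fun h : R => if e then invmx (h *: V + A) else h *: V + A)
    (if e then - (invmx A *m V *m invmx A) else V).
  case: (e); last exact: (line_derive A V).
  have uA : 0 *: V + A \in unitmx by rewrite scale0r add0r posdef_unit.
  by have := is_derive_invmx uA (line_derive A V); rewrite scale0r add0r.
have := is_derive_scalemx hpow hmat; rewrite scale0r add0r => h; apply: is_derive_eq h _.
rewrite /det_power_map_der (gtr0_norm A0) scalerDr scalerA addrC; congr (_ + _ *: _); ring.
Qed.

(** The left-hand side exceeds the right-hand side by k (2 s + n k) times the product
    of the traces of A^-1 V and A^-1 W, where s is the sign of e. *)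
Lemma det_power_map_metric A V W : P A -> S V -> S W ->
  trace_metric (det_power_map e k A) (det_power_map_der A V) (det_power_map_der A W) = trace_metric A V W.
Proof.
move=> PA sV sW; have uA := posdef_unit PA.
set p := `|\det A| `^ k.
have p0 : p != 0 by rewrite gt_eqF // powR_gt0 // normr_gt0 gt_eqF // posdef_det.
have pu : p \is a GRing.unit by rewrite unitfE.
pose B := if e then invmx A else A.
have uB : B \in unitmx by rewrite /B; case: (e) => //; rewrite unitmx_inv.
pose D X := (if e then - (invmx A *m X *m invmx A) else X) : 'M[R]_n.
pose tau X := \tr (invmx A *m X).
have upB : p *: B \in unitmx by rewrite unitmxZ.
have nE X : invmx (det_power_map e k A) *m det_power_map_der A X = invmx B *m D X + (k * tau X)%:M.
  rewrite /det_power_map /det_power_map_der -/p -/B -/(D X) -/(tau X) invmxZ //.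
  rewrite -scalemxAl -scalemxAr scalerA mulVf // scale1r mulmxDr -scalemxAr mulVmx //.
  by rewrite scalemx1.
have tE X : \tr (invmx B *m D X) = s * tau X.
  rewrite /B /D /tau; case: (e); last by rewrite expr0 mul1r.
  rewrite expr1 mulN1r invmxK mulmxN raddfN /= !mulmxA mulmxV // mul1mx.
  by rewrite mxtrace_mulC.
have mE : \tr (invmx B *m D V *m (invmx B *m D W)) = trace_metric A V W.
  rewrite /B /D /trace_metric; case: (e); last by rewrite !mulmxA.
  rewrite invmxK !mulmxN !mulNmx opprK !mulmxA mulmxV // mul1mx mulmxKV //.
  by rewrite mxtrace_mulC !mulmxA.
have -> : trace_metric (det_power_map e k A) (det_power_map_der A V) (det_power_map_der A W) =
   \tr ((invmx (det_power_map e k A) *m det_power_map_der A V) *m (invmx (det_power_map e k A) *m det_power_map_der A W)).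
  by rewrite /trace_metric !mulmxA.
rewrite !nE mulmxDr !mulmxDl !mxtraceD mE.
rewrite mul_mx_scalar mul_scalar_mx -scalar_mxM !mxtraceZ !tE mxtrace_scalar.
rewrite -mulr_natl.
transitivity (trace_metric A V W + k * (2 * s + n%:R * k) * (tau V * tau W)); last first.
  by rewrite k_quad mul0r addr0.
by ring.
Qed.

Lemma det_power_map_isometry M (L : 'M[R]_n -> 'M[R]_n) : M \in unitmx ->
  (forall A, P A -> L A = M *m det_power_map e k A *m M^T) -> trace_isometry L.
Proof.
move=> uM LE; have uK : invmx M \in unitmx by rewrite unitmx_inv.
have KMT : M^T *m (invmx M)^T = 1%:M by rewrite -trmx_mul mulVmx // trmx1.
have KMT' : (invmx M)^T *m M^T = 1%:M by rewrite -trmx_mul mulmxV // trmx1.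
have LP A : P A -> P (L A).
  by move=> PA; rewrite LE //; apply: posdef_congr uM (det_power_map_pos PA).
have elementaryL : elementarymx L.
  apply: (@elementarymx_ext _ _ (fun A => M *m det_power_map e k A *m M^T)).
    by move=> A PA; rewrite LE.
  apply: elementarymx_mul (elementarymx_cst _); apply: elementarymx_mul; first exact: elementarymx_cst.
  by apply: elementarymx_det_power_map; first exact: elementarymx_id.
have KP A : P A -> P (invmx M *m A *m (invmx M)^T) by exact: posdef_congr.
split.
  split=> //; first exact: elementarymx_smooth.
  exists (fun A => det_power_map e k (invmx M *m A *m (invmx M)^T)).
    split; first by move=> A PA; apply: det_power_map_pos; exact: KP.
    apply: elementarymx_smooth; apply: elementarymx_det_power_map => //.
    apply: elementarymx_mul (elementarymx_cst _); apply: elementarymx_mul; first exact: elementarymx_cst.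
    exact: elementarymx_id.
  split=> A /set_mem PA.
    rewrite LE // !mulmxA mulVmx // mul1mx -mulmxA KMT mulmx1.
    exact: det_power_mapK.
  rewrite LE; last exact/det_power_map_pos/KP.
  rewrite (det_power_mapK (KP A PA)) !mulmxA mulmxV // mul1mx -mulmxA KMT'.
  by rewrite mulmx1.
have dL A V : P A -> S V -> 'D_V L A = M *m det_power_map_der A V *m M^T.
  move=> PA sV.
  have h1 := is_derive_rmulmx M^T (is_derive_lmulmx M (is_derive_det_power_map PA sV)).
  have h2 := (is_derive_lineP _ A V _).1 h1.
  suff [] : is_derive A V L (M *m det_power_map_der A V *m M^T) by [].
  apply: (is_derive_lineP _ A V _).2; apply: near_eq_is_derive h2.
  by apply: filterS (posdef_line PA sV) => h Ph; rewrite LE.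
move=> A V W PA sV sW; rewrite !dL // LE // -(det_power_map_metric PA sV sW).
have up := posdef_unit (det_power_map_pos PA).
rewrite /trace_metric (congr_inv uM (mulmxV up)).
set B := invmx (det_power_map e k A); set X := det_power_map_der A V; set Y := det_power_map_der A W.
have gen (Z U U' : 'M[R]_n) : \tr (invmx M^T *m Z *m invmx M *m (M *m U *m M^T) *m
    (invmx M^T *m Z *m invmx M) *m (M *m U' *m M^T)) = \tr (Z *m U *m Z *m U').
  have uMT : M^T \in unitmx by rewrite unitmx_tr.
  rewrite !mulmxA mulmxKV // mulmxK // mulmxKV // mxtrace_mulC !mulmxA mulmxV //.
  by rewrite mul1mx.
exact: gen.
Qed.

End Explicit.

Theorem theorem4p6 (R : realType) (n : nat) (hn : (2 <= n)%N)
    (L : 'M[R]_n -> 'M[R]_n) (hL : set_fun (posdefmx R n) (posdefmx R n) L) :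
  trace_isometry L <->
  exists2 M : 'M[R]_n, M \in unitmx &
    [\/ {in posdefmx R n, L =1 congruence M},
        {in posdefmx R n, L =1 congruence M \o @inversion R n},
        {in posdefmx R n, L =1 congruence M \o @det_scaling R n} |
        {in posdefmx R n, L =1 congruence M \o @inversion R n \o @det_scaling R n}].
Proof.
have inv_scaling A : posdefmx R n A ->
    inversion (det_scaling A) = det_power_map true (2 / n%:R) A.
  move=> PA; have A0 := posdef_det PA.
  have u : `|\det A| `^ (- (2 / n%:R)) \is a GRing.unit.
    by rewrite unitfE gt_eqF // powR_gt0 // normr_gt0 gt_eqF.
  rewrite /inversion /det_scaling /det_power_map invmxZ; last by rewrite unitmxZ // posdef_unit.
  by rewrite -powRN opprK.
split=> [isoL|[M uM]].
  have [M [e [k [uM ke LE]]]] := isometry_form hn isoL.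
  exists M => //; case: ke => kE; subst k; case: e LE => LE.
  - by apply: Or42 => A /set_mem PA; rewrite LE // powRr0 scale1r.
  - by apply: Or41 => A /set_mem PA; rewrite LE // powRr0 scale1r.
  - apply: Or44 => A /set_mem PA; rewrite LE //= /congruence inv_scaling //.
    by rewrite /det_power_map expr1 mulrN mulr1 opprK.
  - by apply: Or43 => A /set_mem PA; rewrite LE //= /congruence /det_scaling expr0 mulr1 mulNr.
have n0 : (0 < n)%N := ltnW hn.
case=> LE.
- apply: (@det_power_map_isometry _ _ false 0 n0 _ M) => //; first by left.
  by move=> A PA; rewrite LE ?mem_set // /det_power_map powRr0 scale1r.
- apply: (@det_power_map_isometry _ _ true 0 n0 _ M) => //; first by left.
  by move=> A PA; rewrite LE ?mem_set // /det_power_map powRr0 scale1r.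
- apply: (@det_power_map_isometry _ _ false (- (2 / n%:R)) n0 _ M) => //.
    by right; rewrite expr0 mulr1 mulNr.
  by move=> A PA; rewrite LE ?mem_set.
- apply: (@det_power_map_isometry _ _ true (2 / n%:R) n0 _ M) => //.
    by right; rewrite expr1 mulrN mulr1 opprK.
  by move=> A PA; rewrite LE ?mem_set //= /congruence inv_scaling.
Qed.
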